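(* Let $k$ be an algebraically closed field of characteristic $0$ and let $A$ be a pseudo-compact dg algebra over $k$. Then $$HG(A)=\begin{cases} k\oplus \mathrm{dJac}(A), & 1\in A \text{ is not exact},\\ k\oplus \mathrm{Jac}(d^{-1}0)[x], & 1\in A\text{ is exact}.\end{cases}$$
   Context: Conventions. $k$ is an algebraically closed field of characteristic $0$; dg means $\mathbb Z$-graded with a differential of degree $-1$; algebras are unital and graded commutative. An element is exact if it equals $da$ for some $a$. A pseudo-compact dg algebra is the inverse limit of a diagram of unital finite-dimensional dg algebras, with the inverse limit topology; morphisms are continuous unital dg algebra maps. A local pseudo-compact dg algebra is one with a unique maximal graded ideal $M$ (possibly not closed under $d$); it is a Hinich algebra if $M$ is closed under $d$, and an acyclic algebra if every closed element is a boundary (every local one is of one of these types). $\mathcal E$ is the full subcategory of local pseudo-compact dg algebras; it has all small limits. Every pseudo-compact dg algebra $A$ is a direct product $\prod_{i\in I}A_i$ of objects $A_i\in\mathcal E$, and this identifies the category of pseudo-compact dg algebras with the category of formal products $\mathrm{Prod}(\mathcal E)$: a morphism $\prod_{i\in I} A_i\to\prod_{j\in J}B_j$ is given by a map $J\to I$, $j\mapsto i_j$, and morphisms $A_{i_j}\to B_j$ in $\mathcal E$. The functor $G$ from pseudo-compact dg algebras to $\mathcal E$ sends $\prod_{i\in I}A_i$ to the categorical product of the $A_i$ in $\mathcal E$ (right adjoint to the inclusion of $\mathcal E$). The functor $H$ from $\mathcal E$ to Hinich algebras sends $A$ with maximal ideal $M$ to $A^H=\{a\in A:da\in M\}$ (right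 adjoint to the inclusion of Hinich algebras in $\mathcal E$). Thus $HG$ is right adjoint to the inclusion of Hinich algebras into pseudo-compact dg algebras. Notation. $\mathrm{dJac}(A)$ is the intersection of all graded maximal differential ideals of $A$. $d^{-1}0\subseteq A$ is the subalgebra of closed elements, and $\mathrm{Jac}$ denotes the Jacobson radical (intersection of graded maximal ideals). For $J=\mathrm{Jac}(d^{-1}0)$, $J[x]$ means $J\oplus xJ$ with $x$ of degree $1$, $x^2=0$, and differential $d(a+xb)=b$ for $a,b\in J$; $k\oplus(-)$ denotes adjoining a unit. Equality means isomorphism of Hinich algebras. *)

(* Defs.v *)
From HB Require Import structures.
From mathcomp Require Import all_boot all_order all_algebra.
From mathcomp Require Import all_classical topology zify.

Set Implicit Arguments.
Unset Strict Implicit.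
Unset Printing Implicit Defensive.

Import GRing.Theory.

Local Open Scope classical_set_scope.
Local Open Scope ring_scope.

(* A k-vector space with a topology.  No compatibility between the two is
   demanded here: it is automatic for pseudo-compact algebras. *)
#[short(type="topLmodType")]
HB.structure Definition TopLmodule (k : fieldType) :=
  {V of Topological V & GRing.Lmodule k V}.
HB.saturate prod.

HB.instance Definition _ (k : fieldType) :=
  GRing.Lmodule.copy (discrete_topology k) k^o.

Section Submodule.
Variables (k : fieldType) (V : topLmodType k).

Record submod := Submod {
  sm_set :> V -> Prop;
  sm0 : sm_set 0;
  smP : forall (c : k) a b, sm_set a -> sm_set b -> sm_set (c *: a + b)
}.

Variable S : submod.

Definition sm_pred : {pred V} := fun x => `[< S x >].

Lemma sm_pred_closed : submod_closed sm_pred.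
Proof.
split; first by apply/asboolP; exact: sm0.
by move=> c a b /asboolP Sa /asboolP Sb; apply/asboolP; exact: smP.
Qed.

HB.instance Definition _ := GRing.isSubmodClosed.Build k V sm_pred sm_pred_closed.

Record sub_mod := SubMod { sm_val : V; sm_valP : sm_val \in sm_pred }.

HB.instance Definition _ := [isSub for sm_val].
HB.instance Definition _ := [Choice of sub_mod by <:].
HB.instance Definition _ := [SubChoice_isSubLmodule of sub_mod by <:].
HB.instance Definition _ := Topological.copy sub_mod (initial_topology sm_val).

Definition subm : topLmodType k := TopLmodule.clone k sub_mod _.

Definition to_sub (x : V) (Sx : S x) : subm :=
  SubMod (introT (asboolP (S x)) Sx).

Definition of_sub (u : subm) : V := sm_val u.

Lemma of_subP (u : subm) : S (of_sub u).
Proof. by apply/asboolP; exact: (sm_valP u). Qed.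

Lemma of_sub_inj : injective of_sub. Proof. exact: val_inj. Qed.

Lemma to_subK (x : V) (Sx : S x) : of_sub (to_sub Sx) = x. Proof. by []. Qed.

Lemma of_subL c u v : of_sub (c *: u + v) = c *: of_sub u + of_sub v.
Proof. exact: (linearP (val : sub_mod -> V)). Qed.

Lemma of_sub0 : of_sub 0 = 0.
Proof. exact: (linear0 (val : sub_mod -> V)). Qed.

Lemma of_subD u v : of_sub (u + v) = of_sub u + of_sub v.
Proof. exact: (linearD (val : sub_mod -> V)). Qed.

Lemma of_subZ c u : of_sub (c *: u) = c *: of_sub u.
Proof. by rewrite -[c *: u]addr0 of_subL of_sub0 addr0. Qed.

End Submodule.

Section Signs.
Variable k : fieldType.

Definition sgn (m : int) : k := (-1) ^ m.

Lemma sgnD m n : sgn (m + n) = sgn m * sgn n.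
Proof. by rewrite /sgn expfzDr // oppr_eq0 oner_eq0. Qed.

Lemma sgn1 : sgn 1 = -1. Proof. by rewrite /sgn expr1z. Qed.

Lemma sgn0 : sgn 0 = 1. Proof. by rewrite /sgn expr0z. Qed.

Lemma sgnN m : sgn (- m) = sgn m.
Proof. by rewrite /sgn -exprz_inv invrN1. Qed.

Lemma sgnn m : sgn m * sgn m = 1.
Proof. by rewrite -{2}sgnN -sgnD subrr sgn0. Qed.

Lemma sgnMB1 m n : sgn (m * (n - 1)) = sgn (m * n) * sgn m.
Proof. by rewrite mulrBr mulr1 sgnD sgnN. Qed.

Lemma sgnB1 m : sgn (m - 1) = - sgn m.
Proof. by rewrite sgnD sgnN sgn1 mulrN1. Qed.

End Signs.

(* Graded objects are families indexed by [int].  The operations take a proof of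
   the equation between the degrees involved, so that no transport between
   equal degrees is needed; such proofs are unique. *)
Record nudga (k : fieldType) := NuDga {
  gr :> int -> topLmodType k;
  dgmul : forall m n p : int, m + n = p -> gr m -> gr n -> gr p;
  dgdiff : forall m n : int, m = n + 1 -> gr m -> gr n;
  mul_linl : forall (m n p : int) (e : m + n = p) (b : gr n),
    linear (fun a : gr m => dgmul e a b);
  mulA : forall (m n p q mn np : int) (e1 : m + n = mn) (e2 : mn + p = q)
      (e3 : n + p = np) (e4 : m + np = q) (a : gr m) (b : gr n) (c : gr p),
    dgmul e2 (dgmul e1 a b) c = dgmul e4 a (dgmul e3 b c);
  mulC : forall (m n p : int) (e : m + n = p) (e' : n + m = p) (a : gr m) (b : gr n),
    dgmul e a b = sgn k (m * n) *: dgmul e' b a;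
  diff_lin : forall (m n : int) (e : m = n + 1), linear (dgdiff e);
  diffK : forall (m n p : int) (e1 : m = n + 1) (e2 : n = p + 1) (a : gr m),
    dgdiff e2 (dgdiff e1 a) = 0;
  leibniz : forall (m n p m' n' p' : int) (e : m + n = p) (em : m = m' + 1)
      (en : n = n' + 1) (ep : p = p' + 1) (e1 : m' + n = p') (e2 : m + n' = p')
      (a : gr m) (b : gr n),
    dgdiff ep (dgmul e a b) =
      dgmul e1 (dgdiff em a) b + sgn k m *: dgmul e2 a (dgdiff en b)
}.

Record dga (k : fieldType) := Dga {
  dga_nu :> nudga k;
  dgone : dga_nu 0;
  mul1 : forall (m : int) (e : 0 + m = m) (a : dga_nu m), dgmul e dgone a = a
}.

Arguments dgmul {k n0 m n p} e _ _ : rename.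
Arguments dgdiff {k n0 m n} e _ : rename.
Arguments dgone {k} d.

Section NuDgaTheory.
Variables (k : fieldType) (N : nudga k).
Implicit Types m n p : int.

Lemma mulL m n p (e : m + n = p) c (a a' : N m) (b : N n) :
  dgmul e (c *: a + a') b = c *: dgmul e a b + dgmul e a' b.
Proof. exact: mul_linl. Qed.

Lemma mul_irr m n p (e e' : m + n = p) (a : N m) (b : N n) :
  dgmul e a b = dgmul e' a b.
Proof. by rewrite (eq_irrelevance e e'). Qed.

Lemma diff_irr m n (e e' : m = n + 1) (a : N m) : dgdiff e a = dgdiff e' a.
Proof. by rewrite (eq_irrelevance e e'). Qed.

Lemma mulR m n p (e : m + n = p) c (a : N m) (b b' : N n) :
  dgmul e a (c *: b + b') = c *: dgmul e a b + dgmul e a b'.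
Proof.
have e' : n + m = p by rewrite addrC.
rewrite (mulC e e') mulL (mulC e e' a b) (mulC e e' a b').
by rewrite scalerDr !scalerA [c * _]mulrC.
Qed.

Lemma mulDl m n p (e : m + n = p) (a a' : N m) (b : N n) :
  dgmul e (a + a') b = dgmul e a b + dgmul e a' b.
Proof. by rewrite -[a]scale1r mulL !scale1r. Qed.

Lemma mulDr m n p (e : m + n = p) (a : N m) (b b' : N n) :
  dgmul e a (b + b') = dgmul e a b + dgmul e a b'.
Proof. by rewrite -[b]scale1r mulR !scale1r. Qed.

Lemma mul0L m n p (e : m + n = p) (b : N n) : dgmul e (0 : N m) b = 0.
Proof. by apply: (addrI (dgmul e (0 : N m) b)); rewrite -mulDl !addr0. Qed.

Lemma mul0R m n p (e : m + n = p) (a : N m) : dgmul e a (0 : N n) = 0.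
Proof. by apply: (addrI (dgmul e a (0 : N n))); rewrite -mulDr !addr0. Qed.

Lemma mulZl m n p (e : m + n = p) c (a : N m) (b : N n) :
  dgmul e (c *: a) b = c *: dgmul e a b.
Proof. by rewrite -[c *: a]addr0 mulL mul0L addr0. Qed.

Lemma mulZr m n p (e : m + n = p) c (a : N m) (b : N n) :
  dgmul e a (c *: b) = c *: dgmul e a b.
Proof. by rewrite -[c *: b]addr0 mulR mul0R addr0. Qed.

Lemma diffL m n (e : m = n + 1) c (a b : N m) :
  dgdiff e (c *: a + b) = c *: dgdiff e a + dgdiff e b.
Proof. exact: diff_lin. Qed.

Lemma diffD m n (e : m = n + 1) (a b : N m) :
  dgdiff e (a + b) = dgdiff e a + dgdiff e b.
Proof. by rewrite -[a]scale1r diffL !scale1r. Qed.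

Lemma diff0 m n (e : m = n + 1) : dgdiff e (0 : N m) = 0.
Proof. by apply: (addrI (dgdiff e (0 : N m))); rewrite -diffD !addr0. Qed.

Lemma diffZ m n (e : m = n + 1) c (a : N m) : dgdiff e (c *: a) = c *: dgdiff e a.
Proof. by rewrite -[c *: a]addr0 diffL diff0 addr0. Qed.

Definition degcast m n (E : m = n) (a : N m) : N n := ecast i (N i) E a.

Lemma degcastL m n (E : m = n) c (a b : N m) :
  degcast E (c *: a + b) = c *: degcast E a + degcast E b.
Proof. by case: _ / E. Qed.

Lemma degcast0 m n (E : m = n) : degcast E (0 : N m) = 0.
Proof. by case: _ / E. Qed.

Lemma degcastD m n (E : m = n) (a b : N m) :
  degcast E (a + b) = degcast E a + degcast E b.
Proof. by case: _ / E. Qed.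

Lemma degcastZ m n (E : m = n) c (a : N m) :
  degcast E (c *: a) = c *: degcast E a.
Proof. by case: _ / E. Qed.

Lemma degcast_mul m n p p' (e : m + n = p) (e' : m + n = p') (E : p = p')
  (a : N m) (b : N n) : degcast E (dgmul e a b) = dgmul e' a b.
Proof. by case: _ / E e'; move=> e'; exact: mul_irr. Qed.

Lemma mul_degcastl m m' n p (E : m = m') (e : m + n = p) (e' : m' + n = p)
  (a : N m) (b : N n) : dgmul e' (degcast E a) b = dgmul e a b.
Proof. by case: _ / E e'; move=> e'; exact: mul_irr. Qed.

Lemma mul_degcastr m n n' p (E : n = n') (e : m + n = p) (e' : m + n' = p)
  (a : N m) (b : N n) : dgmul e' a (degcast E b) = dgmul e a b.
Proof. by case: _ / E e'; move=> e'; exact: mul_irr. Qed.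

(* The identity N_m -> N_n when m = n, and 0 otherwise. *)
Definition tr m n (a : N m) : N n :=
  if m =P n is ReflectT E then degcast E a else 0.

Lemma tr_id m (a : N m) : tr m a = a.
Proof. by rewrite /tr; case: eqP => // E; rewrite (eq_irrelevance E erefl). Qed.

Lemma trL m n c (a b : N m) : tr n (c *: a + b) = c *: tr n a + tr n b.
Proof.
by rewrite /tr; case: eqP => [E|_]; rewrite ?degcastL // scaler0 addr0.
Qed.

Lemma tr0 m n : tr n (0 : N m) = 0.
Proof. by rewrite /tr; case: eqP => // E; rewrite degcast0. Qed.

Lemma trD m n (a b : N m) : tr n (a + b) = tr n a + tr n b.
Proof. by rewrite -[a]scale1r trL !scale1r. Qed.

Lemma trZ m n c (a : N m) : tr n (c *: a) = c *: tr n a.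
Proof. by rewrite -[c *: a]addr0 trL tr0 addr0. Qed.

Lemma tr_mull n p mn np q : n = mn -> np = q ->
  forall (e : mn + p = q) (e' : n + p = np) (b : N n) (c : N p),
  dgmul e (tr mn b) c = tr q (dgmul e' b c).
Proof.
move=> F G; case: mn / F; case: q / G => e e' b c; by rewrite !tr_id; exact: mul_irr.
Qed.

Lemma tr_mulr m p mn np q : m = mn -> p = np ->
  forall (e : mn + p = q) (e' : m + np = q) (a : N m) (c : N p),
  dgmul e (tr mn a) c = dgmul e' a (tr np c).
Proof.
move=> F G; case: mn / F; case: np / G => e e' b c; by rewrite !tr_id; exact: mul_irr.
Qed.

Lemma tr_mul m n mn np q : mn = q -> n = np ->
  forall (e : m + n = mn) (e' : m + np = q) (a : N m) (b : N n),
  tr q (dgmul e a b) = dgmul e' a (tr np b).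
Proof.
move=> F G; case: q / F; case: np / G => e e' b c; by rewrite !tr_id; exact: mul_irr.
Qed.

Lemma tr_tr m n q : m = n -> forall a : N m, tr q (tr n a) = tr q a.
Proof. by move=> F; case: n / F => a; rewrite tr_id. Qed.

Lemma tr_diff m n m' n' : m = n -> m' = n' ->
  forall (e : m = m' + 1) (e' : n = n' + 1) (a : N m),
  dgdiff e' (tr n a) = tr n' (dgdiff e a).
Proof.
move=> F G; case: n / F; case: n' / G => e e' a; by rewrite !tr_id; exact: diff_irr.
Qed.

End NuDgaTheory.

Lemma diff1 (k : fieldType) (A : dga k) n (e : 0 = n + 1) : dgdiff e (dgone A) = 0.
Proof.
have e0 : 0 + 0 = 0 :> int by [].
have el : n + 0 = n by rewrite addr0.
have er : 0 + n = n by rewrite add0r.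
have := leibniz e0 e e e el er (dgone A) (dgone A).
rewrite mul1 mul1 sgn0 scale1r (mulC el er) mulr0 sgn0 scale1r mul1.
by move/(congr1 (fun x => x - dgdiff e (dgone A))); rewrite subrr addrK.
Qed.

Section Sub.
Variables (k : fieldType).

(* The unit need not belong to the subspace. *)
Record dgsub (N : nudga k) := DgSub {
  ds_set :> forall n, submod (N n);
  dsM : forall m n p (e : m + n = p) (a : N m) (b : N n),
    ds_set m a -> ds_set n b -> ds_set p (dgmul e a b);
  dsd : forall m n (e : m = n + 1) (a : N m), ds_set m a -> ds_set n (dgdiff e a)
}.

Section NonUnital.
Variables (N : nudga k) (S : dgsub N).

Definition sub_mul m n p (e : m + n = p) (a : subm (S m)) (b : subm (S n)) :
    subm (S p) :=
  to_sub (dsM e (of_subP a) (of_subP b)).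

Definition sub_diff m n (e : m = n + 1) (a : subm (S m)) : subm (S n) :=
  to_sub (dsd e (of_subP a)).

Definition sub_nudga : nudga k.
Proof.
refine (@NuDga k (fun n => subm (S n)) sub_mul sub_diff _ _ _ _ _ _).
- move=> m n p e b c a a'; apply: of_sub_inj.
  by rewrite of_subL !to_subK of_subL mulL.
- by move=> *; apply: of_sub_inj; exact: mulA.
- by move=> m n p e e' a b; apply: of_sub_inj; rewrite of_subZ; exact: mulC.
- move=> m n e c a b; apply: of_sub_inj.
  by rewrite of_subL !to_subK of_subL diffL.
- by move=> *; apply: of_sub_inj; rewrite of_sub0; exact: diffK.
- move=> m n p m' n' p' e em en ep e1 e2 a b; apply: of_sub_inj.
  by rewrite of_subD of_subZ; exact: leibniz.
Defined.

End NonUnital.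

Definition sub_dga (A : dga k) (S : dgsub A) (S1 : S 0 (dgone A)) : dga k.
Proof.
refine (@Dga k (sub_nudga S) (to_sub S1) _).
by move=> m e a; apply: of_sub_inj; exact: mul1.
Defined.

End Sub.

(* N[x] = N (+) xN with |x| = 1, x^2 = 0: the pair (a, b) stands for a + xb, so
     (a + xb)(a' + xb') = aa' + x(ba' + (-1)^|a| ab'),   d(a + xb) = b.
   The differential of N is not used. *)
Section AdjoinX.
Variables (k : fieldType) (N : nudga k).

Definition ax_gr (n : int) : topLmodType k :=
  TopLmodule.clone k (N n * N (n - 1))%type _.

Lemma ax_e1 (m n p : int) : m + n = p -> (m - 1) + n = p - 1. Proof. lia. Qed.
Lemma ax_e2 (m n p : int) : m + n = p -> m + (n - 1) = p - 1. Proof. lia. Qed.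
Lemma ax_e3 (m n : int) : m = n + 1 -> m - 1 = n. Proof. lia. Qed.

Definition ax_mul m n p (e : m + n = p) (u : ax_gr m) (v : ax_gr n) : ax_gr p :=
  (dgmul e u.1 v.1,
   dgmul (ax_e1 e) u.2 v.1 + sgn k m *: dgmul (ax_e2 e) u.1 v.2).

Definition ax_diff m n (e : m = n + 1) (u : ax_gr m) : ax_gr n :=
  (degcast (ax_e3 e) u.2, 0).

Definition adjoin_x : nudga k.
Proof.
refine (@NuDga k ax_gr ax_mul ax_diff _ _ _ _ _ _).
- move=> m n p e v c u u'; congr pair => /=; first exact: mulL.
  rewrite !mulL !scalerDr !scalerA [c * _]mulrC -!addrA; congr (_ + _).
  by rewrite addrCA.
- move=> m n p q mn np e1 e2 e3 e4 u v w; congr pair => /=; first exact: mulA.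
  have -> : sgn k mn = sgn k m * sgn k n by rewrite -e1 sgnD.
  rewrite mulDl mulZl mulDr mulZr scalerDr scalerA -addrA.
  by congr (_ + (_ *: _ + _ *: _)); apply: mulA.
- move=> m n p e e' u v; congr pair => /=; first exact: mulC.
  have x1 : n + (m - 1) = p - 1 by lia.
  have x2 : (n - 1) + m = p - 1 by lia.
  rewrite (mulC (ax_e1 e) x1) (mulC (ax_e2 e) x2) scalerDr !scalerA.
  rewrite mulrBl mul1r sgnD sgnN sgnMB1 mulrCA sgnn mulr1 [LHS]addrC.
  by congr (_ *: _ + _ *: _); exact: mul_irr.
- move=> m n e c u v; congr pair => /=; first exact: degcastL.
  by rewrite scaler0 addr0.
- by move=> m n p e1 e2 u; congr pair => /=; exact: degcast0.
- move=> m n p m' n' p' e em en ep e1 e2 u v.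
  have x1 : (m - 1) + n = p' by lia.
  have x2 : m + (n - 1) = p' by lia.
  have y : (m - 1) + (n - 1) = p' - 1 by lia.
  congr pair => /=.
    rewrite degcastD degcastZ (degcast_mul _ x1) (degcast_mul _ x2).
    by rewrite (mul_degcastl _ x1) (mul_degcastr _ x2).
  rewrite mul0L mul0R scaler0 add0r addr0 (mul_degcastl _ y) (mul_degcastr _ y).
  by have -> : m' = m - 1; [lia | rewrite sgnB1 scaleNr addNr].
Defined.

End AdjoinX.

(* k (+) N, with k in degree 0: the pair (c, a) stands for c + a. *)
Section AdjoinUnit.
Variables (k : fieldType) (N : nudga k).

Definition au_pair (n : int) : topLmodType k :=
  TopLmodule.clone k (discrete_topology k * N n)%type _.

Definition au_sub (n : int) : submod (au_pair n).
Proof.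
refine (@Submod k (au_pair n) (fun u => n <> 0 -> u.1 = 0) _ _) => //.
by move=> c u v hu hv n0 /=; rewrite hu // hv // scaler0 addr0.
Defined.

Definition au_gr (n : int) : topLmodType k := subm (au_sub n).

Definition au_scal n (u : au_gr n) : k := (of_sub u).1.
Definition au_part n (u : au_gr n) : N n := (of_sub u).2.

Definition au_mul_pair m n p (e : m + n = p) (u : au_gr m) (v : au_gr n) :
    au_pair p :=
  (au_scal u * au_scal v,
   au_scal u *: tr p (au_part v) + au_scal v *: tr p (au_part u)
   + dgmul e (au_part u) (au_part v)).

Lemma au_scal0 n (u : au_gr n) : n <> 0 -> au_scal u = 0.
Proof. exact: (of_subP u). Qed.

Lemma au_mulP m n p (e : m + n = p) (u : au_gr m) (v : au_gr n) :
  au_sub p (au_mul_pair e u v).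
Proof.
move=> p0 /=; have [m0|/eqP m0] := eqVneq m 0; last first.
  by rewrite (au_scal0 u m0) mul0r.
have n0 : n <> 0 by move=> n0; apply: p0; lia.
by rewrite (au_scal0 v n0) mulr0.
Qed.

Definition au_mul m n p (e : m + n = p) (u : au_gr m) (v : au_gr n) : au_gr p :=
  to_sub (au_mulP e u v).

Lemma au_diffP m n (e : m = n + 1) (u : au_gr m) :
  au_sub n (0, dgdiff e (au_part u)).
Proof. by []. Qed.

Definition au_diff m n (e : m = n + 1) (u : au_gr m) : au_gr n :=
  to_sub (au_diffP e u).

Lemma au_eq n (u v : au_gr n) :
  au_scal u = au_scal v -> au_part u = au_part v -> u = v.
Proof.
move=> h1 h2; apply: of_sub_inj.
by rewrite [LHS]surjective_pairing [RHS]surjective_pairing; congr pair.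
Qed.

Lemma au_scalL n c (u v : au_gr n) :
  au_scal (c *: u + v) = c * au_scal u + au_scal v.
Proof. by rewrite /au_scal of_subL. Qed.

Lemma au_partL n c (u v : au_gr n) :
  au_part (c *: u + v) = c *: au_part u + au_part v.
Proof. by rewrite /au_part of_subL. Qed.

Lemma au_scale_eq n m (u : au_gr m) (x y : N n) :
  (m = 0 -> x = y) -> au_scal u *: x = au_scal u *: y.
Proof.
move=> h; have [/h-> //|/eqP m0] := eqVneq m 0.
by rewrite au_scal0 // !scale0r.
Qed.

Lemma au_oneP : au_sub 0 (1, 0). Proof. by []. Qed.

Lemma au_scalM m n p (e : m + n = p) (u : au_gr m) (v : au_gr n) :
  au_scal (au_mul e u v) = au_scal u * au_scal v.
Proof. by []. Qed.

Lemma au_partM m n p (e : m + n = p) (u : au_gr m) (v : au_gr n) :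
  au_part (au_mul e u v) =
    au_scal u *: tr p (au_part v) + au_scal v *: tr p (au_part u)
    + dgmul e (au_part u) (au_part v).
Proof. by []. Qed.

Lemma au_scald m n (e : m = n + 1) (u : au_gr m) : au_scal (au_diff e u) = 0.
Proof. by []. Qed.

Lemma au_partd m n (e : m = n + 1) (u : au_gr m) :
  au_part (au_diff e u) = dgdiff e (au_part u).
Proof. by []. Qed.

Lemma au_scalZ n c (u : au_gr n) : au_scal (c *: u) = c * au_scal u.
Proof. by rewrite /au_scal of_subZ. Qed.

Lemma au_partZ n c (u : au_gr n) : au_part (c *: u) = c *: au_part u.
Proof. by rewrite /au_part of_subZ. Qed.

Lemma au_scalD n (u v : au_gr n) : au_scal (u + v) = au_scal u + au_scal v.
Proof. by rewrite /au_scal of_subD. Qed.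

Lemma au_partD n (u v : au_gr n) : au_part (u + v) = au_part u + au_part v.
Proof. by rewrite /au_part of_subD. Qed.

Lemma au_partA m n p q mn np (e1 : m + n = mn) (e2 : mn + p = q)
    (e3 : n + p = np) (e4 : m + np = q) (u : au_gr m) (v : au_gr n)
    (w : au_gr p) :
  au_part (au_mul e2 (au_mul e1 u v) w) = au_part (au_mul e4 u (au_mul e3 v w)).
Proof.
rewrite !au_partM !au_scalM.
move: (au_part u) (au_part v) (au_part w) => a b c.
set x := au_scal u; set y := au_scal v; set z := au_scal w.
rewrite !trD !trZ !mulDl !mulDr !mulZl !mulZr !scalerDr !scalerA.
have E1 : x *: dgmul e2 (tr mn b) c = x *: tr q (dgmul e3 b c).
  by apply: au_scale_eq => m0; apply: tr_mull; lia.
have E2 : y *: dgmul e2 (tr mn a) c = y *: dgmul e4 a (tr np c).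
  by apply: au_scale_eq => n0; apply: tr_mulr; lia.
have E3 : z *: tr q (dgmul e1 a b) = z *: dgmul e4 a (tr np b).
  by apply: au_scale_eq => p0; apply: tr_mul; lia.
have E4 : x *: (y *: tr q c) = x *: (y *: tr q (tr np c)).
  apply: au_scale_eq => m0; apply: au_scale_eq => n0.
  by rewrite (@tr_tr _ _ p np q) //; lia.
have E5 : z *: (x *: tr q (tr mn b)) = z *: (x *: tr q (tr np b)).
  apply: au_scale_eq => p0; apply: au_scale_eq => m0.
  by rewrite (@tr_tr _ _ n mn q) ?(@tr_tr _ _ n np q) //; lia.
have E6 : z *: (y *: tr q (tr mn a)) = z *: (y *: tr q a).
  apply: au_scale_eq => p0; apply: au_scale_eq => n0.
  by rewrite (@tr_tr _ _ m mn q) //; lia.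
rewrite !scalerA in E4 E5 E6.
rewrite (mulA e1 e2 e3 e4) E1 E2 E3 E4 E5 E6.
rewrite -!addrA; congr (_ + _); rewrite [z * x]mulrC [z * y]mulrC.
congr (_ + _); rewrite [RHS]addrCA; congr (_ + _).
by rewrite [LHS]addrCA; congr (_ + _); rewrite addrCA.
Qed.

Definition au_nudga : nudga k.
Proof.
refine (@NuDga k au_gr au_mul au_diff _ _ _ _ _ _).
- move=> m n p e v c u u'; apply: au_eq.
    by rewrite au_scalL !au_scalM au_scalL mulrDl mulrA.
  rewrite au_partL !au_partM au_scalL au_partL mulL trL !scalerDr !scalerDl.
  rewrite !scalerA [c * _]mulrC [au_scal v * c]mulrC.
  by rewrite (addrACA ((au_scal u * c) *: _)) [LHS]addrACA.
- move=> *; apply: au_eq; last exact: au_partA.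
  by rewrite !au_scalM mulrA.
- move=> m n p e e' u v; apply: au_eq.
    rewrite au_scalZ !au_scalM [au_scal v * _]mulrC.
    have [m0|/eqP m0] := eqVneq m 0; last by rewrite (au_scal0 u m0) mul0r mulr0.
    by have -> : sgn k (m * n) = 1; [rewrite m0 mul0r sgn0 | rewrite mul1r].
  rewrite au_partZ !au_partM !scalerDr -mulC.
  congr (_ + _); rewrite [LHS]addrC; congr (_ + _).
  + rewrite scalerA [_ * au_scal v]mulrC -scalerA.
    apply: au_scale_eq => n0.
    by have -> : sgn k (m * n) = 1; [rewrite n0 mulr0 sgn0 | rewrite scale1r].
  + rewrite scalerA [_ * au_scal u]mulrC -scalerA.
    apply: au_scale_eq => m0.
    by have -> : sgn k (m * n) = 1; [rewrite m0 mul0r sgn0 | rewrite scale1r].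
- move=> m n e c u v; apply: au_eq; first by rewrite au_scalL !au_scald mulr0 addr0.
  by rewrite au_partL !au_partd au_partL diffL.
- move=> m n p e1 e2 u; apply: au_eq; first by rewrite /au_scal of_sub0.
  by rewrite !au_partd diffK /au_part of_sub0.
- move=> m n p m' n' p' e em en ep e1 e2 u v; apply: au_eq.
    by rewrite au_scalD au_scalZ !au_scalM !au_scald mul0r !mulr0 addr0.
  rewrite au_partD au_partZ au_partd !au_partM !au_partd !au_scald.
  rewrite !diffD !diffZ (leibniz e em en ep e1 e2) !scale0r add0r addr0.
  rewrite scalerDr addrA [RHS]addrA; congr (_ + _).
  have E1 : au_scal u *: dgdiff ep (tr p (au_part v)) =
      sgn k m *: (au_scal u *: tr p' (dgdiff en (au_part v))).
    rewrite scalerA [sgn _ _ * _]mulrC -scalerA.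
    apply: au_scale_eq => m0.
    have -> : sgn k m = 1; [by rewrite m0 sgn0 | rewrite scale1r].
    by apply: tr_diff; lia.
  have E2 : au_scal v *: dgdiff ep (tr p (au_part u)) =
      au_scal v *: tr p' (dgdiff em (au_part u)).
    by apply: au_scale_eq => n0; apply: tr_diff; lia.
  by rewrite E1 E2 -addrA [LHS]addrC.
Defined.

Definition adjoin_unit : dga k.
Proof.
refine (@Dga k au_nudga (to_sub au_oneP : au_gr 0) _).
move=> m e u; apply: au_eq; first by rewrite au_scalM mul1r.
by rewrite au_partM /au_scal /au_part /= scale1r tr_id tr0 scaler0 addr0 mul0L addr0.
Defined.

End AdjoinUnit.

(* Ideals are not required to be topologically closed. *)
Section Ideals.
Variable k : fieldType.

Definition gset (N : nudga k) := forall n : int, set (N n).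

Definition gset_le (N : nudga k) (I J : gset N) := forall n, I n `<=` J n.

(* One-sided and two-sided ideals agree by graded commutativity. *)
Definition graded_ideal (N : nudga k) (I : gset N) : Prop :=
  [/\ forall n, I n 0,
      forall n (c : k) (a b : N n), I n a -> I n b -> I n (c *: a + b) &
      forall m n p (e : m + n = p) (a : N m) (b : N n),
        I n b -> I p (dgmul e a b)].

Definition diff_closed (N : nudga k) (I : gset N) : Prop :=
  forall m n (e : m = n + 1) (a : N m), I m a -> I n (dgdiff e a).

Definition graded_diff_ideal (N : nudga k) (I : gset N) : Prop :=
  graded_ideal I /\ diff_closed I.

Definition proper_gset (N : nudga k) (I : gset N) : Prop :=
  exists n (a : N n), ~ I n a.

Definition maximal_among (N : nudga k) (P : gset N -> Prop) (I : gset N) : Prop :=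
  [/\ P I, proper_gset I &
      forall J, P J -> proper_gset J -> gset_le I J -> gset_le J I].

Definition max_ideal (A : dga k) : gset A -> Prop :=
  maximal_among (@graded_ideal A).

Definition max_diff_ideal (A : dga k) : gset A -> Prop :=
  maximal_among (@graded_diff_ideal A).

Definition Jac (A : dga k) : gset A :=
  fun n => [set a | forall I, max_ideal I -> I n a].

Definition dJac (A : dga k) : gset A :=
  fun n => [set a | forall I, max_diff_ideal I -> I n a].

Definition ideal_dgsub (N : nudga k) (I : gset N) (hI : graded_diff_ideal I) :
  dgsub N.
Proof.
unshelve refine (@DgSub k N (fun n => @Submod k (N n) (I n) _ _) _ _).
- by case: hI => -[h0 hl hM] hd; exact: h0.
- by case: hI => -[h0 hl hM] hd; exact: hl.
- by case: hI => -[h0 hl hM] hd m n p e a b _; exact: hM.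
- by case: hI => -[h0 hl hM] hd; exact: hd.
Defined.

Lemma dJac_ideal (A : dga k) : graded_diff_ideal (dJac (A := A)).
Proof.
split; first split.
- by move=> n I [[[h0 hl hM] hd] _ _]; exact: h0.
- move=> n c a b Ia Ib I hI; have [[[_ hl _] _] _ _] := hI.
  by apply: hl; [exact: Ia | exact: Ib].
- move=> m n p e a b Ib I hI; have [[[_ _ hM] _] _ _] := hI.
  by apply: hM; exact: Ib.
- move=> m n e a Ia I hI; have [[_ hd] _ _] := hI.
  by apply: hd; exact: Ia.
Qed.

Definition closed_dgsub (A : dga k) : dgsub A.
Proof.
pose Z n (a : A n) := forall m (e : n = m + 1), dgdiff e a = 0.
unshelve refine (@DgSub k A (fun n => @Submod k (A n) (Z n) _ _) _ _).
- by move=> m e; exact: diff0.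
- by move=> c a b Za Zb m e; rewrite diffL Za Zb scaler0 addr0.
- move=> m n p e a b Za Zb q ep /=.
  have em : m = (m - 1) + 1 by lia.
  have en : n = (n - 1) + 1 by lia.
  have e1 : (m - 1) + n = q by lia.
  have e2 : m + (n - 1) = q by lia.
  by rewrite (leibniz e em en ep e1 e2) Za Zb mul0L mul0R scaler0 addr0.
- by move=> m n e a Za q e'; exact: diffK.
Defined.

(* d^{-1}0 *)
Definition closed_dga (A : dga k) : dga k :=
  @sub_dga k A (closed_dgsub A) (diff1 A).

Lemma Jac_closed_ideal (A : dga k) : graded_diff_ideal (Jac (A := closed_dga A)).
Proof.
split; first split.
- by move=> n I [[h0 hl hM] _ _]; exact: h0.
- move=> n c a b Ia Ib I hI; have [[_ hl _] _ _] := hI.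
  by apply: hl; [exact: Ia | exact: Ib].
- move=> m n p e a b Ib I hI; have [[_ _ hM] _ _] := hI.
  by apply: hM; exact: Ib.
- move=> m n e a Ia I hI; have [[h0 _ _] _ _] := hI.
  suff -> : dgdiff e a = 0 by exact: h0.
  by apply: of_sub_inj; rewrite of_sub0; exact: (of_subP a).
Qed.

(* k (+) dJac(A) *)
Definition k_dJac (A : dga k) : dga k :=
  adjoin_unit (sub_nudga (ideal_dgsub (dJac_ideal A))).

(* k (+) Jac(d^{-1}0)[x] *)
Definition k_Jac_closed_x (A : dga k) : dga k :=
  adjoin_unit (adjoin_x (sub_nudga (ideal_dgsub (Jac_closed_ideal A)))).

Definition is_exact (A : dga k) n (b : A n) : Prop :=
  exists m (e : m = n + 1) (a : A m), dgdiff e a = b.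

End Ideals.

Section Categories.
Variable k : fieldType.

Record dghom (A B : dga k) := DgHom {
  hom_fun :> forall n, A n -> B n;
  hom_lin : forall n, linear (@hom_fun n);
  hom1 : hom_fun (dgone A) = dgone B;
  homM : forall (m n p : int) (e : m + n = p) (a : A m) (b : A n),
    hom_fun (dgmul e a b) = dgmul e (hom_fun a) (hom_fun b);
  homd : forall (m n : int) (e : m = n + 1) (a : A m),
    hom_fun (dgdiff e a) = dgdiff e (hom_fun a);
  hom_cont : forall n, continuous (@hom_fun n)
}.

Definition dg_iso (A B : dga k) : Prop :=
  exists (f : dghom A B) (g : dghom B A),
    (forall n (a : A n), g n (f n a) = a) /\ (forall n (b : B n), f n (g n b) = b).

(* [pr] exhibits A as the inverse limit of the diagram D with arrows [phi], with
   the inverse limit topology.  The shape of the diagram is a quiver: composition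
   of arrows is irrelevant to the limit. *)
Definition is_limit (I : Type) (Q : I -> I -> Type) (D : I -> dga k)
    (phi : forall i j, Q i j -> dghom (D i) (D j))
    (A : dga k) (pr : forall i, dghom A (D i)) : Prop :=
  [/\ forall i j (u : Q i j) n (a : A n), phi i j u n (pr i n a) = pr j n a,
      forall n (x : forall i, D i n),
        (forall i j (u : Q i j), phi i j u n (x i) = x j) ->
        exists! a : A n, forall i, pr i n a = x i &
      forall n, @open (A n) =
        @open (sup_topology (fun i => Topological.class
                 (initial_topology (pr i n : A n -> D i n))))].

Definition is_product (I : Type) (D : I -> dga k) (A : dga k)
    (pr : forall i, dghom A (D i)) : Prop :=
  @is_limit I (fun _ _ => void) D (fun _ _ u => match u with end) A pr.

Definition finite_dim (A : dga k) : Prop :=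
  (exists N : nat, forall n : int, (N < `|n|)%N -> forall a : A n, a = 0) /\
  forall n, exists (r : nat) (v : 'I_r -> A n),
    forall a : A n, exists c : 'I_r -> k, a = \sum_i c i *: v i.

Definition is_discrete (A : dga k) : Prop := forall n (U : set (A n)), open U.

Definition pseudo_compact (A : dga k) : Prop :=
  exists (I : Type) (Q : I -> I -> Type) (D : I -> dga k)
      (phi : forall i j, Q i j -> dghom (D i) (D j))
      (pr : forall i, dghom A (D i)),
    (forall i, finite_dim (D i) /\ is_discrete (D i)) /\ is_limit phi pr.

Definition is_local (A : dga k) : Prop := exists! M : gset A, max_ideal M.

(* The bare type dga does not ask the topology to be compatible with the
   operations; in pcdga it is the inverse limit topology. *)
Record pcdga := PcDga { pc_dga :> dga k; pc_pc : pseudo_compact pc_dga }.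

(* Objects of the category E. *)
Record locpc := LocPc { loc_pc :> pcdga; loc_local : is_local loc_pc }.

Definition maximal_ideal (A : locpc) : gset A := sval (cid (loc_local A)).

Lemma maximal_idealP (A : locpc) : max_ideal (maximal_ideal (A := A)).
Proof. by rewrite /maximal_ideal; case: cid => M []. Qed.

Definition is_hinich (A : dga k) : Prop :=
  exists (pcA : pseudo_compact A) (locA : is_local A),
    diff_closed (maximal_ideal (A := LocPc (loc_pc := PcDga pcA) locA)).

Definition hinich_iso (A B : dga k) : Prop :=
  [/\ is_hinich A, is_hinich B & dg_iso A B].

(* [pr] exhibits P as the product of the A_i in the category E. *)
Definition is_E_product (I : Type) (A_ : I -> locpc) (P : locpc)
    (pr : forall i, dghom P (A_ i)) : Prop :=
  forall (B : locpc) (f : forall i, dghom B (A_ i)),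
  exists g : dghom B P,
    (forall i n (b : B n), pr i n (g n b) = f i n b) /\
    (forall g' : dghom B P,
       (forall i n (b : B n), pr i n (g' n b) = f i n b) ->
       forall n (b : B n), g' n b = g n b).

(* P is a value of G at A: A decomposes as a product of objects A_i of E, and P
   is the product of the A_i in E. *)
Definition is_G (A : pcdga) (P : locpc) : Prop :=
  exists (I : Type) (A_ : I -> locpc)
      (p : forall i, dghom A (A_ i)) (q : forall i, dghom P (A_ i)),
    is_product p /\ is_E_product q.

Definition hinich_dgsub (P : locpc) : dgsub P.
Proof.
pose S n (a : P n) := forall m (e : n = m + 1), maximal_ideal (dgdiff e a).
unshelve refine (@DgSub k P (fun n => @Submod k (P n) (S n) _ _) _ _);
  have [[h0 hl hM] _ _] := maximal_idealP P.
- by move=> m e; rewrite diff0; exact: h0.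
- by move=> c a b Sa Sb m e; rewrite diffL; apply: hl; [exact: Sa | exact: Sb].
- move=> m n p e a b Sa Sb q ep /=.
  have em : m = (m - 1) + 1 by lia.
  have en : n = (n - 1) + 1 by lia.
  have e1 : (m - 1) + n = q by lia.
  have e2 : m + (n - 1) = q by lia.
  have e1' : n + (m - 1) = q by lia.
  rewrite (leibniz e em en ep e1 e2) addrC; apply: (hl); first exact/hM/Sb.
  rewrite (mulC e1 e1') -[_ *: _]addr0; apply: hl; last exact: h0.
  exact/hM/Sa.
- by move=> m n e a Sa q e'; rewrite diffK; exact: h0.
Defined.

Lemma hinich_dgsub1 (P : locpc) : hinich_dgsub P 0 (dgone P).
Proof.
move=> m e; rewrite diff1.
by have [[h0 _ _] _ _] := maximal_idealP P; exact: h0.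
Qed.

(* P^H = {a in P : da in M} *)
Definition hinich_part (P : locpc) : dga k := sub_dga (hinich_dgsub1 P).

End Categories.

(* Main.v *)
From HB Require Import structures.
From mathcomp Require Import all_boot all_order all_algebra.
From mathcomp Require Import all_classical topology zify.
Require Import Defs.

(** Let A be the product of the local algebras A_i, with maximal ideals M_i, and
    let N consist of the a in A such that all components of a and of da lie in
    the M_i. A Hinich algebra is B = k (+) M_B with M_B closed under d, and
    morphisms of local algebras preserve augmentations, so a morphism from B to A
    sends M_B into N: morphisms B -> A are the same as morphisms
    B -> k (+) N. Since k (+) N is itself a Hinich algebra, it represents the
    functor B |-> Hom(B, A) on Hinich algebras, and so does P^H. Concretely, the
    projections of k (+) N to the A_i induce a morphism to P which lands in P^H;
    the morphisms P^H -> P -> A_i induce a morphism to A which factors through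
    k (+) N; the two are inverse to each other by the uniqueness clauses of the
    two products ([is_G_iso]). Thus P^H = k (+) N.

    Four facts make this work.

    - A local pseudo-compact algebra has residue field k ([locpc_aug]). It maps to
      a nonzero finite-dimensional algebra with kernel inside the maximal ideal;
      there elements of nonzero degree are nilpotent, and elements of degree 0
      are roots of polynomials, which split into linear factors.
    - dJac(A) = N ([dJacE]). The product may be infinite and maximal
      ideals need not be closed, so many of them do not come from a factor; still
      all of them contain N, because 1 + N consists of units.
    - k (+) N is pseudo-compact ([k_dJac_pc]): it is the fibre product over k of
      the algebras k (+) N_i, N_i being the ideal N of the one-factor product A_i,
      and an explicit diagram of finite-dimensional algebras is assembled from
      diagrams for the A_i. It is local with maximal ideal N.
    - P^H = k (+) dJac(P) ([hinich_self]), so that the previous facts, applied to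
      P as a product with one factor, show that P^H is a Hinich algebra.

    If 1 = dy, then y^2 = 0 because y is odd, and a = (a - y da) + y da writes A
    as Z (+) yZ, where Z is the algebra of closed elements. The same argument on
    units shows that Jac(Z) consists of the closed elements with all components
    in the M_i, so that a + xb |-> a + yb is an isomorphism from Jac(Z)[x] onto
    N ([acyclic_iso]). *)

Set Implicit Arguments.
Unset Strict Implicit.
Unset Printing Implicit Defensive.

Import GRing.Theory.

Local Open Scope classical_set_scope.
Local Open Scope ring_scope.

(** * Topologies *)

Section Topology.

Definition all_open (T : topologicalType) := forall U : set T, open U.

Lemma discrete_all_open (T : choiceType) : all_open (discrete_topology T).
Proof. by move=> U; exact: discrete_open. Qed.

Lemma near_all_open (X T : topologicalType) (f : X -> T) (x : X) :
  all_open T -> continuous f -> \forall z \near x, f z = f x.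
Proof.
move=> dT cf; have : nbhs (f x) [set f x] by apply: open_nbhs_nbhs; split.
by move/cf; rewrite nbhs_filterE.
Qed.

Lemma near_const_continuous (X T : topologicalType) (f : X -> T) :
  (forall x, \forall z \near x, f z = f x) -> continuous f.
Proof.
move=> cf x A fA; change (nbhs x (f @^-1` A)); apply: filterS (cf x) => z /= ->.
exact: nbhs_singleton.
Qed.

Lemma all_open_continuous1 (X T Y : topologicalType) (h : T -> Y) (f : X -> T) :
  all_open T -> continuous f -> continuous (fun x => h (f x)).
Proof.
move=> dT cf; apply: near_const_continuous => x.
by apply: filterS (near_all_open x dT cf) => z ->.
Qed.

Lemma all_open_continuous2 (X T T' Y : topologicalType) (h : T -> T' -> Y)
    (f : X -> T) (g : X -> T') :
  all_open T -> all_open T' -> continuous f -> continuous g ->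
  continuous (fun x => h (f x) (g x)).
Proof.
move=> dT dT' cf cg; apply: near_const_continuous => x.
by apply: filterS2 (near_all_open x dT cf) (near_all_open x dT' cg) => z -> ->.
Qed.

Lemma inj_all_open (X T : topologicalType) (f : X -> T) :
  all_open T -> continuous f -> injective f -> all_open X.
Proof.
move=> dT /continuousP cf fI U; rewrite (_ : U = f @^-1` (f @` U)); first exact: cf.
by apply/seteqP; split=> [x Ux|x [y Uy /fI <-]] //; exists x.
Qed.

Lemma comp_continuous (X Y Z : topologicalType) (f : X -> Y) (g : Y -> Z) :
  continuous f -> continuous g -> continuous (fun x => g (f x)).
Proof. by move=> cf cg x; apply: continuous_comp; [exact: cf | exact: cg]. Qed.

Lemma pair_continuous (X Y Z : topologicalType) (f : X -> Y) (g : X -> Z) :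
  continuous f -> continuous g -> continuous (fun x => (f x, g x)).
Proof. by move=> cf cg x; apply: cvg_pair; [exact: cf | exact: cg]. Qed.

Lemma fst_cont (Y Z : topologicalType) : continuous (fst : Y * Z -> Y).
Proof. by move=> x; exact: cvg_fst. Qed.

Lemma snd_cont (Y Z : topologicalType) : continuous (snd : Y * Z -> Z).
Proof. by move=> x; exact: cvg_snd. Qed.

Lemma of_sub_cont (k : fieldType) (V : topLmodType k) (S : submod V) :
  continuous (@of_sub k V S).
Proof. exact: initial_continuous. Qed.

Lemma subm_continuous (k : fieldType) (V : topLmodType k) (S : submod V)
    (X : topologicalType) (f : X -> subm S) :
  continuous (fun x => of_sub (f x)) -> continuous f.
Proof. exact: continuous_comp_initial. Qed.

End Topology.

(** The topology is initial, expressed through its universal property. In this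
    form it can be composed along limits of limits. *)
Definition initial_family (k : fieldType) (I : Type) (A : dga k) (D : I -> dga k)
    (pr : forall i, dghom A (D i)) :=
  forall n (X : topologicalType) (f : X -> A n),
    (forall i, continuous (fun x => pr i n (f x))) -> continuous f.

Lemma initial_familyP (k : fieldType) (I : Type) (A : dga k) (D : I -> dga k)
    (pr : forall i, dghom A (D i)) :
  initial_family pr <->
  forall n, @open (A n) =
        @open (sup_topology (fun i => Topological.class
                 (initial_topology (pr i n : A n -> D i n)))).
Proof.
split=> [ini n|eq_open n X f cf].
  apply/seteqP; split=> U oU.
    pose S := sup_topology (fun i => Topological.class
                 (initial_topology (pr i n : A n -> D i n))).
    have cid : continuous (id : S -> A n).
      apply: ini => i x B /= nB.
      have := @cvg_sup _ _ (fun i => Topological.class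
                 (initial_topology (pr i n : A n -> D i n))) (nbhs (x : S)) x
                 (nbhs_filter (x : S)).
      case=> /(_ (fun _ h => h)) /(_ i) h _; apply: h.
      exact: (@initial_continuous _ _ (pr i n) x B nB).
    by move/continuousP: cid => /(_ U oU).
  rewrite openE => x Ux.
  rewrite openE in oU; move: (oU x Ux).
  rewrite /interior.
  have := @cvg_sup _ _ (fun i => Topological.class
                 (initial_topology (pr i n : A n -> D i n))) (nbhs (x : A n)) x
                 (nbhs_filter x).
  case=> _; apply=> i B /= [_ [[C oC <-] /= Cx] CB].
  apply: filterS CB _.
  have /= := @hom_cont _ _ _ (pr i) n x C; apply.
  exact: open_nbhs_nbhs.
apply/continuousP => U; rewrite eq_open => oU.
have : continuous (f : X -> sup_topology (fun i => Topological.class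
                 (initial_topology (pr i n : A n -> D i n)))).
  move=> x; apply/cvg_sup => i B /= [_ [[C oC <-] /= Cx] CB].
  rewrite nbhs_filterE; apply: filterS (fun _ => @CB _) _.
  by apply: cf; exact: open_nbhs_nbhs.
by move/continuousP; apply.
Qed.

(** * Units, ideals and augmentations *)

Section Units.
Variables (k : fieldType) (B : dga k).

Lemma deg00 : 0 + 0 = 0 :> int. Proof. by []. Qed.

Lemma mul1l m p (e : 0 + m = p) (E : m = p) (a : B m) :
  dgmul e (dgone B) a = degcast E a.
Proof. by case: _ / E e => e; exact: mul1. Qed.

Lemma dgmulr1 m (e : m + 0 = m) (a : B m) : dgmul e a (dgone B) = a.
Proof.
have e' : 0 + m = m by rewrite add0r.
by rewrite (mulC e e') mulr0 sgn0 scale1r mul1.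
Qed.

Lemma mulC0 (a b : B 0) : dgmul deg00 a b = dgmul deg00 b a.
Proof. by rewrite (mulC deg00 deg00) mulr0 sgn0 scale1r. Qed.

Definition is_unit (a : B 0) := exists v : B 0, dgmul deg00 a v = dgone B.

Lemma diffN m n (e : m = n + 1) (a : B m) : dgdiff e (- a) = - dgdiff e a.
Proof. by rewrite -scaleN1r diffZ scaleN1r. Qed.

Lemma diffB m n (e : m = n + 1) (a b : B m) :
  dgdiff e (a - b) = dgdiff e a - dgdiff e b.
Proof. by rewrite diffD diffN. Qed.

Lemma mulNl m n p (e : m + n = p) (a : B m) (b : B n) :
  dgmul e (- a) b = - dgmul e a b.
Proof. by rewrite -scaleN1r mulZl scaleN1r. Qed.

Lemma mulNr m n p (e : m + n = p) (a : B m) (b : B n) :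
  dgmul e a (- b) = - dgmul e a b.
Proof. by rewrite -scaleN1r mulZr scaleN1r. Qed.

Lemma mulBl m n p (e : m + n = p) (a a' : B m) (b : B n) :
  dgmul e (a - a') b = dgmul e a b - dgmul e a' b.
Proof. by rewrite mulDl mulNl. Qed.

Lemma mulBr m n p (e : m + n = p) (a : B m) (b b' : B n) :
  dgmul e a (b - b') = dgmul e a b - dgmul e a b'.
Proof. by rewrite mulDr mulNr. Qed.

End Units.

Section HomTheory.
Variables (k : fieldType) (A B : dga k) (f : dghom A B).

Lemma homL n c (a b : A n) : f n (c *: a + b) = c *: f n a + f n b.
Proof. exact: hom_lin. Qed.

Lemma homD n (a b : A n) : f n (a + b) = f n a + f n b.
Proof. by rewrite -[a]scale1r homL !scale1r. Qed.

Lemma hom0 n : f n 0 = 0.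
Proof. by apply: (addrI (f n 0)); rewrite -homD !addr0. Qed.

Lemma homZ n c (a : A n) : f n (c *: a) = c *: f n a.
Proof. by rewrite -[c *: a]addr0 homL hom0 addr0. Qed.

Lemma homB n (a b : A n) : f n (a - b) = f n a - f n b.
Proof. by rewrite homD -scaleN1r homZ scaleN1r. Qed.

Lemma hom_tr m n (a : A m) : f n (tr n a) = tr n (f m a).
Proof. by rewrite /tr; case: eqP => [E|_]; [case: _ / E | rewrite hom0]. Qed.

Lemma hom_unit (a : A 0) : is_unit a -> is_unit (f 0 a).
Proof. by case=> v av; exists (f 0 v); rewrite -homM av hom1. Qed.

End HomTheory.

Section Preimages.
Variables (k : fieldType) (A B : dga k) (f : dghom A B).

Lemma preimage_ideal (I : gset B) :
  graded_ideal I -> graded_ideal (fun n => [set a : A n | I n (f n a)]).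
Proof.
case=> h0 hL hM; split=> [n|n c a b Ia Ib|m n p e a b Ib] /=.
- by rewrite hom0.
- by rewrite homL; exact: hL.
- by rewrite homM; exact: hM.
Qed.

Lemma kernel_ideal : graded_ideal (fun n => [set a : A n | f n a = 0]).
Proof.
split=> [n|n c a b /= fa fb|m n p e a b /= fb]; first exact: hom0.
- by rewrite homL fa fb scaler0 addr0.
- by rewrite homM fb mul0R.
Qed.

End Preimages.

Section Ideals.
Variables (k : fieldType) (B : dga k).
Implicit Types I J : gset B.

Section Ideal.
Variable I : gset B.
Arguments I : clear implicits.
Hypothesis hI : graded_ideal I.

Lemma ideal0 n : I n 0. Proof. by case: hI. Qed.

Lemma idealL n c (a b : B n) : I n a -> I n b -> I n (c *: a + b).
Proof. by case: hI => _ h _; exact: h. Qed.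

Lemma idealD n (a b : B n) : I n a -> I n b -> I n (a + b).
Proof. by move=> Ia Ib; rewrite -[a]scale1r; exact: idealL. Qed.

Lemma idealZ n c (a : B n) : I n a -> I n (c *: a).
Proof. by move=> Ia; rewrite -[_ *: _]addr0; apply: idealL => //; exact: ideal0. Qed.

Lemma idealB n (a b : B n) : I n a -> I n b -> I n (a - b).
Proof. by move=> Ia Ib; rewrite addrC -scaleN1r; exact: idealL. Qed.

Lemma idealMl m n p (e : m + n = p) (a : B m) (b : B n) :
  I n b -> I p (dgmul e a b).
Proof. by case: hI => _ _ h; exact: h. Qed.

Lemma idealMr m n p (e : m + n = p) (a : B m) (b : B n) :
  I m a -> I p (dgmul e a b).
Proof.
have e' : n + m = p by rewrite addrC.
by move=> Ia; rewrite (mulC e e'); apply/idealZ/idealMl.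
Qed.

Lemma ideal1_full : I 0 (dgone B) -> forall n (a : B n), I n a.
Proof.
by move=> I1 n a; rewrite -(dgmulr1 (addr0 n) a); exact: idealMl.
Qed.

Lemma properP : proper_gset I <-> ~ I 0 (dgone B).
Proof.
split=> [[n [a nIa]] I1|nI1]; first by apply: nIa; exact: ideal1_full.
by exists 0, (dgone B).
Qed.

Lemma ideal_unit (a : B 0) : is_unit a -> I 0 a -> I 0 (dgone B).
Proof. by case=> v <- Ia; exact: idealMr. Qed.

(** Zorn's lemma for sets X of homogeneous elements such that the union of I and
    X is a proper ideal. Adding I makes the empty chain no exception. *)
Lemma proper_sub_max :
  proper_gset I -> exists2 M, max_ideal M & gset_le I M.
Proof.
move=> /properP nI1.
pose T := {n : int & B n}.
pose G (X : set T) : gset B := fun n => [set a | I n a \/ X (existT _ n a)].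
pose P (X : set T) := graded_ideal (G X) /\ ~ G X 0 (dgone B).
have GS X Y : X `<=` Y -> gset_le (G X) (G Y).
  by move=> XY n a [Ia|Xa]; [left | right; exact: XY].
have [F FP Ftot|X [[PX nX1] Xmax]] := @Zorn_bigcup T P.
  have cover n a : G (\bigcup_(X in F) X) n a ->
      I n a \/ exists2 X, F X & G X n a.
    by case=> [Ia|[X FX Xa]]; [left | right; exists X => //; right].
  have GF X : F X -> gset_le (G X) (G (\bigcup_(X in F) X)).
    by move=> FX; apply: GS => t Xt; exists X.
  split; last first.
    by case/cover=> // -[X /FP[_ nX1] X1].
  split.
  - by move=> n; left; exact: ideal0.
  - move=> n c a b /cover[Ia|[X FX Xa]] /cover[Ib|[Y FY Yb]].
    + by left; exact: idealL.
    + apply: (GF _ FY); have [[_ hL _] _] := FP _ FY.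
      by apply: hL => //; left.
    + apply: (GF _ FX); have [[_ hL _] _] := FP _ FX.
      by apply: hL => //; left.
    + have [XY|YX] := Ftot _ _ FX FY.
      * apply: (GF _ FY); have [[_ hL _] _] := FP _ FY.
        by apply: hL => //; exact: (GS _ _ XY).
      * apply: (GF _ FX); have [[_ hL _] _] := FP _ FX.
        by apply: hL => //; exact: (GS _ _ YX).
  - move=> m n p e a b /cover[Ib|[X FX Xb]]; first by left; exact: idealMl.
    apply: (GF _ FX); have [[_ _ hM] _] := FP _ FX.
    exact: hM.
exists (G X); last by move=> n a; left.
split=> //; first by exists 0, (dgone B).
move=> J hJ [m [z nJz]] XJ n a Ja; apply: contrapT => nXa.
pose Y : set T := fun t => J (projT1 t) (projT2 t).
have GY p (b : B p) : G Y p b <-> J p b.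
  by split=> [[Ib|//]|Jb]; [apply: XJ; left | right].
have eGY : G Y = J.
  by apply: functional_extensionality_dep => p; apply/seteqP; split=> b /GY.
apply: (Xmax Y); last first.
  rewrite /P eGY; split=> // J1; apply: nJz.
  by case: (hJ) => _ _ hM; rewrite -(dgmulr1 (addr0 m) z); exact: hM.
split; first by move=> [q b] Xb; apply: XJ; right.
by move=> YX; apply: nXa; right; apply: YX.
Qed.

End Ideal.

Definition principal n (a : B n) : gset B :=
  fun m => [set x | exists b : B (m - n), x = dgmul (subrK n m) b a].

Lemma principal_ideal n (a : B n) : graded_ideal (principal a).
Proof.
split.
- by move=> m; exists 0; rewrite mul0L.
- by move=> m c x y [b ->] [b' ->]; exists (c *: b + b'); rewrite mulL.
- move=> m p q e x y [b ->].
  have e' : m + (p - n) = q - n by lia.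
  by exists (dgmul e' x b); rewrite (mulA e' (subrK n q) (subrK n p) e).
Qed.

Lemma principal_mem n (a : B n) : principal a a.
Proof.
have e : 0 = n - n by rewrite subrr.
exists (degcast e (dgone B)); have e0 : 0 + n = n by rewrite add0r.
by rewrite (mul_degcastl e e0) mul1.
Qed.

End Ideals.

(** A character need not vanish on boundaries: the augmentation of an acyclic local
    algebra does not. This is why it is not a dg morphism to k. *)
Record is_char (k : fieldType) (B : dga k)
    (e : forall n, B n -> discrete_topology k) : Prop := IsChar {
  charL : forall n c (a b : B n), e n (c *: a + b) = c * e n a + e n b;
  char1 : e 0 (dgone B) = 1;
  char_deg : forall n (a : B n), n <> 0 -> e n a = 0;
  charM : forall m n p (h : m + n = p) (a : B m) (b : B n),
    e p (dgmul h a b) = e m a * e n b;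
  char_cont : forall n, continuous (e n)
}.

(** The augmentation of a local algebra with residue field k. *)
Record is_aug (k : fieldType) (B : dga k)
    (e : forall n, B n -> discrete_topology k) : Prop := IsAug {
  aug_char :> is_char e;
  aug_unit : forall a : B 0, e 0 a <> 0 -> is_unit a
}.

Section Augmentation.
Variables (k : fieldType) (B : dga k) (e : forall n, B n -> discrete_topology k).
Hypothesis he : is_aug e.

Lemma augD n (a b : B n) : e (a + b) = e a + e b.
Proof. by rewrite -{1}[a]scale1r (charL he) mul1r. Qed.

Lemma aug0 n : e (0 : B n) = 0.
Proof. by apply: (addrI (e (0 : B n))); rewrite -augD !addr0. Qed.

Lemma augZ n c (a : B n) : e (c *: a) = c * e a.
Proof. by rewrite -[c *: a]addr0 (charL he) aug0 addr0. Qed.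

Lemma augB n (a b : B n) : e (a - b) = e a - e b.
Proof. by rewrite augD -scaleN1r augZ mulN1r. Qed.

Definition aug_ker : gset B := fun n => [set a | e a = 0].

Lemma aug_ker_ideal : graded_ideal aug_ker.
Proof.
split=> [n|n c a b /= ea eb|m n p h a b /= eb]; first exact: aug0.
- by rewrite /aug_ker /= (charL he) ea eb mulr0 addr0.
- by rewrite /aug_ker /= (charM he) eb mulr0.
Qed.

Lemma aug_ker_proper : proper_gset aug_ker.
Proof.
by exists 0, (dgone B); rewrite /aug_ker /= (char1 he); apply/eqP; exact: oner_neq0.
Qed.

Lemma sub_aug_ker I : graded_ideal I -> proper_gset I -> gset_le I aug_ker.
Proof.
move=> hI /(properP hI) pI n a Ia; apply: contrapT => ea.
have [n0|/eqP n0] := eqVneq n 0; last by apply: ea; exact: (char_deg he).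
by subst n; apply: pI; apply: ideal_unit Ia => //; exact: aug_unit ea.
Qed.

Lemma aug_ker_max : max_ideal aug_ker.
Proof.
split; [exact: aug_ker_ideal | exact: aug_ker_proper |].
by move=> J hJ pJ _; exact: sub_aug_ker.
Qed.

Lemma aug_ker_unique M : max_ideal M -> M = aug_ker.
Proof.
move=> [hM pM mM]; have Mle := sub_aug_ker hM pM.
apply: functional_extensionality_dep => n; apply/seteqP; split; first exact: Mle.
exact: mM aug_ker_ideal aug_ker_proper Mle n.
Qed.

Lemma aug_local : is_local B.
Proof. by exists aug_ker; split=> [|M /aug_ker_unique]; [exact: aug_ker_max | ]. Qed.

Lemma aug_hinich : pseudo_compact B ->
  (forall m n (h : m = n + 1) (a : B m), e (dgdiff h a) = 0) -> is_hinich B.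
Proof.
move=> pcB ed; exists pcB, aug_local.
pose L := LocPc (loc_pc := PcDga pcB) aug_local.
rewrite (aug_ker_unique (maximal_idealP L)) => m n h a _; exact: ed.
Qed.

End Augmentation.

(** If the augmentation c of g b were not that of b, then b - c would be a unit
    with a non-unit image. In particular morphisms of local algebras preserve the
    maximal ideals, and not only reflect them. *)
Lemma hom_aug (k : fieldType) (B C : dga k)
    (e : forall n, B n -> discrete_topology k)
    (e' : forall n, C n -> discrete_topology k) (g : dghom B C) :
  is_aug e -> is_aug e' -> forall n (b : B n), e' n (g n b) = e n b.
Proof.
move=> he he' n b.
have [n0|/eqP n0] := eqVneq n 0; last by rewrite (char_deg he) // (char_deg he').
subst n; apply: contrapT => ne.
set c := e' 0 (g 0 b).
have /(hom_unit g) : is_unit (b - c *: dgone B).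
  apply: (aug_unit he); rewrite (augB he) (augZ he) (char1 he) mulr1.
  by move/subr0_eq => E; apply: ne; rewrite -/c E.
rewrite homB homZ hom1 => -[v] /(congr1 (e' 0)).
rewrite (charM he') (augB he') (augZ he') (char1 he') mulr1 subrr mul0r => /esym/eqP.
by rewrite oner_eq0.
Qed.

(** * The augmentation of a local pseudo-compact algebra *)

Definition spanned (k : fieldType) (V : lmodType k) :=
  exists (r : nat) (v : 'I_r -> V), forall a : V, exists c : 'I_r -> k,
    a = \sum_i c i *: v i.

Lemma spanned_dep (k : fieldType) (V : lmodType k) (u : nat -> V) : spanned V ->
  exists2 f : {poly k}, f != 0 & \sum_(i < size f) f`_i *: u i = 0.
Proof.
case=> r [v sp].
have /choice[c uE] : forall i, exists c : 'I_r -> k, u i = \sum_j c j *: v j.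
  by move=> i; exact: sp.
pose C := \matrix_(i < r.+1, j < r) c i j.
have : kermx C != 0.
  rewrite -mxrank_eq0 mxrank_ker -lt0n subn_gt0.
  exact: leq_ltn_trans (rank_leq_col C) _.
move=> /rowV0Pn[w /sub_kermxP wC w0].
pose f := \poly_(i < r.+1) w 0 (inord i).
have wE (i : 'I_r.+1) : f`_i = w 0 i by rewrite coef_poly ltn_ord inord_val.
exists f.
  apply: contraNneq w0 => f0; apply/eqP/rowP => i.
  by rewrite -wE f0 coef0 mxE.
have -> : \sum_(i < size f) f`_i *: u i = \sum_(i < r.+1) f`_i *: u i.
  rewrite (big_ord_widen r.+1 (fun i => f`_i *: u i)) ?size_poly // big_mkcond.
  by apply: eq_bigr => i _; case: ltnP => // /leq_sizeP -> //; rewrite scale0r.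
under eq_bigr => i _ do rewrite wE uE scaler_sumr.
rewrite exchange_big big1 // => j _ /=.
under eq_bigr => i _ do rewrite scalerA.
rewrite -scaler_suml.
have := congr1 (fun M : 'rV_r => M 0 j) wC; rewrite !mxE => E.
rewrite (_ : \sum_i _ = 0) ?scale0r // -[RHS]E.
by apply: eq_bigr => i _; rewrite mxE.
Qed.

Section PolyEval.
Variables (k : fieldType) (B : dga k) (p : B 0).

Fixpoint power i : B 0 := if i is j.+1 then dgmul deg00 p (power j) else dgone B.

Definition poly_eval (f : {poly k}) : B 0 := \sum_(i < size f) f`_i *: power i.

Lemma poly_evalE n (f : {poly k}) : (size f <= n)%N ->
  poly_eval f = \sum_(i < n) f`_i *: power i.
Proof.
move=> fn; rewrite /poly_eval (big_ord_widen n (fun i => f`_i *: power i)) //.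
rewrite big_mkcond; apply: eq_bigr => i _.
by case: ltnP => // /leq_sizeP -> //; rewrite scale0r.
Qed.

Lemma mul_sumr n (F : 'I_n -> B 0) :
  dgmul deg00 p (\sum_i F i) = \sum_i dgmul deg00 p (F i).
Proof.
elim: n F => [F|n IH F]; first by rewrite !big_ord0 mul0R.
by rewrite !big_ord_recr /= mulDr IH.
Qed.

Lemma poly_eval_factor g c :
  poly_eval (g * ('X - c%:P)) = dgmul deg00 (p - c *: dgone B) (poly_eval g).
Proof.
rewrite (@poly_evalE (size g).+1); last first.
  by rewrite (leq_trans (size_polyMleq _ _)) // size_XsubC addn2.
rewrite mulBl mulZl mul1 {2}(@poly_evalE (size g).+1) // /poly_eval mul_sumr.
rewrite scaler_sumr.
under eq_bigr => i _ do rewrite mulrBr coefB coefMX coefMC scalerBl.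
rewrite sumrB big_ord_recl /= scale0r add0r; congr (_ - _).
  by apply: eq_bigr => i _; rewrite mulZr.
by apply: eq_bigr => i _; rewrite scalerA [c * _]mulrC.
Qed.

End PolyEval.

(** The elements u and v are the powers a^N and b^N; their degrees are existential
    because they are known up to an equation only. *)
Lemma mulr_iter (k : fieldType) (B : dga k) n n' (e : n + n' = 0) (a : B n)
    (b : B n') : dgmul e a b = dgone B -> forall N : nat,
  exists (m m' : int) (u : B m) (v : B m') (h : m + m' = 0),
    m = n *+ N /\ dgmul h u v = dgone B.
Proof.
move=> ab; elim=> [|N [m [m' [u [v [h [mE uv]]]]]]].
  by exists 0, 0, (dgone B), (dgone B), deg00; rewrite mul1.
have e1 : m + n = m + n by [].
have e2 : n' + m' = n' + m' by [].
have e3 : (m + n) + (n' + m') = 0 by lia.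
have e4 : n + (n' + m') = m' by lia.
exists (m + n), (n' + m'), (dgmul e1 u a), (dgmul e2 b v), e3.
split; first by rewrite mE mulrSr.
rewrite (mulA e1 e3 e4 h); have e5 : 0 + m' = m' by lia.
by rewrite -(mulA e e5 e2 e4) ab mul1.
Qed.

(** The morphism f to a finite-dimensional algebra exhibits B as an algebra with
    residue field k: its kernel lies in the maximal ideal M because 1 survives in
    D, and elements of D are tested by dimension and degree. *)
Section LocalAug.
Variables (k : closedFieldType) (B D : dga k) (f : dghom B D) (M : gset B).
Hypothesis maxM : max_ideal M.
Hypothesis uniqM : forall J : gset B, max_ideal J -> M = J.
Hypotheses (finD : finite_dim D) (disD : is_discrete D) (D1 : dgone D <> 0).
Arguments M : clear implicits.

Let hM : graded_ideal M. Proof. by case: maxM. Qed.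

Let nM1 : ~ M 0 (dgone B).
Proof. by apply/(properP hM); case: maxM. Qed.

Lemma proper_sub_local I : graded_ideal I -> ~ I 0 (dgone B) -> gset_le I M.
Proof.
move=> hI /(properP hI)/(proper_sub_max hI)[J maxJ IJ].
by rewrite (uniqM maxJ).
Qed.

Lemma ker_sub_local n (a : B n) : f n a = 0 -> M n a.
Proof.
move=> fa; apply: (proper_sub_local (kernel_ideal f)) fa.
by rewrite /= hom1.
Qed.

Lemma notin_local_inv n (a : B n) : ~ M n a ->
  exists (b : B (0 - n)) , dgmul (subrK n 0) b a = dgone B.
Proof.
move=> nMa; apply: contrapT => nb; apply: nMa.
apply: (proper_sub_local (principal_ideal a)) (principal_mem a) => -[b ab].
by apply: nb; exists b.
Qed.

Lemma notin_local_unit (a : B 0) : ~ M 0 a -> is_unit a.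
Proof.
move=> /notin_local_inv[b ab]; exists b; rewrite mulC0 -ab; exact: mul_irr.
Qed.

Lemma local_prime (a b : B 0) : M 0 (dgmul deg00 a b) -> M 0 a \/ M 0 b.
Proof.
move=> Mab; have [Ma|/notin_local_unit[v av]] := pselect (M 0 a); first by left.
right; rewrite -[b](mul1 deg00) -av (mulC0 a) (mulA deg00 deg00 deg00 deg00).
exact: idealMl.
Qed.

(** Outside M, an element of nonzero degree and all its powers would be
    invertible, but the degrees of D are bounded. *)
Lemma local_deg n (a : B n) : n <> 0 -> M n a.
Proof.
move=> n0; apply: contrapT => /notin_local_inv[b ba].
have [[N bigN] _] := finD.
have [m [m' [u [v [h [mE uv]]]]]] := mulr_iter ba N.+1.
have fu0 : f m u = 0 by apply: bigN; rewrite mE -mulr_natr abszM; nia.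
by apply: D1; rewrite -(hom1 f) -uv homM fu0 mul0L.
Qed.

(** The polynomial splits into linear factors and M is prime. *)
Lemma poly_root_local (p : B 0) (g : {poly k}) :
  g != 0 -> M 0 (poly_eval p g) -> exists c, M 0 (p - c *: dgone B).
Proof.
have [N] := ubnP (size g); elim: N g => // N IH g gN g0 Mg.
have [/size_poly1P[c c0 gE]|/closed_rootP[c /factor_theorem[q gE]]] :=
    boolP (size g == 1%N).
  case: nM1; have := idealZ hM c^-1 Mg.
  rewrite gE (@poly_evalE _ _ _ 1) ?size_polyC ?leq_b1 //.
  by rewrite big_ord1 coefC /= scalerA mulVf // scale1r.
move: Mg; rewrite gE poly_eval_factor => /local_prime[Mc|]; first by exists c.
have q0 : q != 0 by apply: contraNneq g0 => q0; rewrite gE q0 mul0r.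
apply: IH => //; move: gN; rewrite gE size_Mmonic ?monicXsubC // size_XsubC.
by rewrite addn2.
Qed.

(** By finite dimension, f a satisfies a nonzero polynomial equation in D. *)
Lemma residue_ex n (a : B n) :
  exists c : k, (n <> 0 -> c = 0) /\ M n (a - c *: tr n (dgone B)).
Proof.
have [n0|/eqP n0] := eqVneq n 0; last first.
  by exists 0; split=> //; rewrite scale0r subr0; exact: local_deg.
subst n; have [_ /(_ 0) sp] := finD.
have [g g0 gE] := spanned_dep (fun i => f 0 (power a i)) sp.
have [|c Mc] := @poly_root_local a g g0; last by exists c; rewrite tr_id.
apply: ker_sub_local; rewrite -[RHS]gE /poly_eval.
elim: (size g) => [|N IH]; first by rewrite !big_ord0 hom0.
by rewrite !big_ord_recr /= homD homZ IH.
Qed.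

Lemma residue_uniq n (a : B n) c c' :
  (n <> 0 -> c = 0) /\ M n (a - c *: tr n (dgone B)) ->
  (n <> 0 -> c' = 0) /\ M n (a - c' *: tr n (dgone B)) -> c = c'.
Proof.
move=> [c0 Mc] [c'0 Mc'].
have [n0|/eqP n0] := eqVneq n 0; last by rewrite c0 // c'0.
subst n; apply: contrapT => /eqP cc; apply: nM1.
have := idealZ hM (c - c')^-1 (idealB hM Mc' Mc).
rewrite tr_id opprB [X in _ *: X]addrC addrA subrK -scalerBl scalerA.
by rewrite mulVf ?scale1r // subr_eq0.
Qed.

Definition residue n (a : B n) : discrete_topology k := sval (cid (residue_ex a)).

Lemma residueP n (a : B n) :
  (n <> 0 -> residue a = 0) /\ M n (a - residue a *: tr n (dgone B)).
Proof. by rewrite /residue; case: cid. Qed.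

Lemma residue_eq n (a : B n) c :
  (n <> 0 -> c = 0) -> M n (a - c *: tr n (dgone B)) -> residue a = c.
Proof. by move=> c0 Mc; apply: residue_uniq (residueP a) _. Qed.

Lemma residue_aug : is_aug residue.
Proof.
have res0 n (a : B n) : residue a = 0 -> M n a.
  by move=> a0; have [_] := residueP a; rewrite a0 scale0r subr0.
split; first split.
- move=> n c a b; have [a0 Ma] := residueP a; have [b0 Mb] := residueP b.
  apply: residue_eq => [n0|]; first by rewrite a0 // b0 // mulr0 addr0.
  rewrite scalerDl -scalerA opprD addrACA -scalerBr.
  exact: idealL.
- by apply: residue_eq => //; rewrite tr_id scale1r subrr; exact: ideal0.
- by move=> n a n0; have [->] := residueP a.
- move=> m n p h a b; have [a0 Ma] := residueP a; have [b0 Mb] := residueP b.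
  apply: residue_eq.
    move=> p0; have [m0|/eqP m0] := eqVneq m 0; last by rewrite a0 // mul0r.
    by rewrite b0 ?mulr0 //; lia.
  have [m0|/eqP m0] := eqVneq m 0; last first.
    by rewrite a0 // mul0r scale0r subr0; apply: (idealMr hM); exact: local_deg.
  have [n0|/eqP n0] := eqVneq n 0; last first.
    by rewrite b0 // mulr0 scale0r subr0; apply: (idealMl hM); exact: local_deg.
  have p0 : p = 0 by rewrite -h m0 n0.
  move: h; rewrite p0; subst m n => h; move: Ma Mb; rewrite !tr_id => Ma Mb.
  rewrite -[X in _ - X](_ : dgmul h (residue a *: dgone B) (residue b *: dgone B) = _).
    rewrite -[dgmul h a b](subrK (dgmul h (residue a *: dgone B) b)) -mulBl.
    by rewrite -addrA -mulBr; apply: (idealD hM); [exact: idealMr | exact: idealMl].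
  by rewrite mulZl mulZr mul1 scalerA.
(* The residue is locally constant because M contains the open kernel of f. *)
- move=> n; apply: near_const_continuous => x.
  apply: filterS (near_all_open x (@disD n) (@hom_cont _ _ _ f n)) => z fz.
  have [x0 Mx] := residueP x; apply: residue_eq => //.
  rewrite -[z](subrK x) -addrA; apply: (idealD hM) => //.
  by apply: ker_sub_local; rewrite homB fz subrr.
- move=> a ra; apply: notin_local_unit => Ma; apply: ra.
  by apply: residue_eq => //; rewrite scale0r subr0.
Qed.

End LocalAug.

(** Otherwise 0 and 1 would have the same projections. *)
Lemma limit_one_neq0 (k : fieldType) (I : Type) (Q : I -> I -> Type)
    (D : I -> dga k) (phi : forall i j, Q i j -> dghom (D i) (D j)) (A : dga k)
    (pr : forall i, dghom A (D i)) :
  is_limit phi pr -> dgone A <> 0 -> exists i, dgone (D i) <> 0.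
Proof.
move=> [comp lim _] A1; apply: contrapT => nD; apply: A1.
have [a [_ aU]] := lim 0 (fun i => 0) (fun i j u => hom0 _ _).
have <- : a = dgone A.
  apply: aU => i; rewrite hom1; apply: contrapT => Di; apply: nD.
  by exists i.
by apply: aU => i; rewrite hom0.
Qed.

(** Every local pseudo-compact algebra has residue field k: some node of a
    presentation as a limit is nonzero, and it controls the residue field. *)
Lemma locpc_aug (k : closedFieldType) (P : locpc k) :
  exists e : forall n, P n -> discrete_topology k,
    is_aug e /\ forall n (a : P n), maximal_ideal a <-> e n a = 0.
Proof.
have maxM := maximal_idealP P.
have uniqM J : max_ideal J -> @maximal_ideal k P = J.
  by move: (@maximal_ideal k P) (loc_local P) maxM => M [M' [_ U]] /U <- /U.
have [I [Q [D [phi [pr [fd lim]]]]]] := pc_pc P.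
have [i Di] : exists i, dgone (D i) <> 0.
  apply: limit_one_neq0 lim _ => P1; have [hM pM _] := maxM.
  by move/(properP hM): pM; apply; rewrite P1; exact: ideal0.
have [fdi disi] := fd i.
pose e := @residue k P (D i) (pr i) _ maxM uniqM fdi Di.
have he : is_aug e := residue_aug (pr i) maxM uniqM fdi disi Di.
exists e; split=> // n a.
by rewrite {1}(aug_ker_unique he maxM).
Qed.

(** * Adjoining a unit to an ideal *)

Section Constants.
Variables (k : fieldType) (B : dga k).

(** The scalar c in degree n: zero unless n = 0. Having it in every degree avoids
    a case distinction on degrees in c + a. *)
Definition scalar n (c : k) : B n := c *: tr n (dgone B).

Lemma scalar0c c : scalar 0 c = c *: dgone B.
Proof. by rewrite /scalar tr_id. Qed.

Lemma scalar0 n : scalar n 0 = 0. Proof. exact: scale0r. Qed.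

Lemma scalarL n c x y : scalar n (c * x + y) = c *: scalar n x + scalar n y.
Proof. by rewrite /scalar scalerDl scalerA. Qed.

Lemma scalar_mull m n p (h : m + n = p) c (a : B n) : (m <> 0 -> c = 0) ->
  dgmul h (scalar m c) a = c *: tr p a.
Proof.
have [m0 _|/eqP m0 /(_ m0) ->] := eqVneq m 0; last first.
  by rewrite scalar0 mul0L scale0r.
move: h; rewrite m0 => h; have np : n = p by rewrite -h add0r.
by move: h; case: p / np => h; rewrite scalar0c tr_id mulZl mul1.
Qed.

Lemma scalar_mulr m n p (h : m + n = p) c (a : B m) : (n <> 0 -> c = 0) ->
  dgmul h a (scalar n c) = c *: tr p a.
Proof.
have [n0 _|/eqP n0 /(_ n0) ->] := eqVneq n 0; last first.
  by rewrite scalar0 mul0R scale0r.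
move: h; rewrite n0 => h; have mp : m = p by rewrite -h addr0.
by move: h; case: p / mp => h; rewrite scalar0c tr_id mulZr dgmulr1.
Qed.

Lemma scalar_diff m n (h : m = n + 1) c : dgdiff h (scalar m c) = 0.
Proof.
have [m0|/eqP m0] := eqVneq m 0.
  by move: h; rewrite m0 => h; rewrite scalar0c diffZ diff1 scaler0.
by rewrite /scalar /tr; case: eqP => [E|_]; [case: m0 | rewrite scaler0 diff0].
Qed.

End Constants.
Arguments scalar {k} B n c.

Lemma hom_scalar (k : fieldType) (A B : dga k) (f : dghom A B) n c :
  f n (scalar A n c) = scalar B n c.
Proof. by rewrite /scalar homZ hom_tr hom1. Qed.

(** The topology of a dga is not required to be compatible with the vector space
    structure; this is the compatibility that makes (c, a) |-> c + a
    continuous. *)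
Definition scalar_add_continuous (k : fieldType) (B : dga k) :=
  forall n (X : topologicalType) (c : X -> discrete_topology k) (f : X -> B n),
    continuous c -> continuous f -> continuous (fun x => scalar B n (c x) + f x).

Section AdjoinUnitTopology.
Variables (k : fieldType) (N : nudga k).
Local Notation K := (adjoin_unit N).

Lemma au_scal_cont n : continuous (@au_scal k N n : K n -> discrete_topology k).
Proof.
exact: comp_continuous (@of_sub_cont _ _ (au_sub N n)) (@fst_cont _ _).
Qed.

Lemma au_part_cont n : continuous (@au_part k N n : K n -> N n).
Proof.
exact: comp_continuous (@of_sub_cont _ _ (au_sub N n)) (@snd_cont _ _).
Qed.

Lemma to_au_continuous n (X : topologicalType) (f : X -> K n) :
  continuous (fun x => au_scal (f x) : discrete_topology k) ->
  continuous (fun x => au_part (f x)) -> continuous f.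
Proof.
move=> cs cp; apply: subm_continuous.
rewrite (_ : (fun x => _) = (fun x => (au_scal (f x), au_part (f x)))).
  exact: pair_continuous.
by apply: functional_extensionality_dep => x; exact: surjective_pairing.
Qed.

End AdjoinUnitTopology.

Section AdjoinUnitOfSub.
Variables (k : fieldType) (B : dga k) (S : dgsub B).
Local Notation N := (sub_nudga S).
Local Notation K := (adjoin_unit N).

(** The pair (c, a) read as the element c + a of B. Together with c it determines
    the pair, and it is multiplicative, so that identities in the algebra with
    adjoined unit reduce to identities in B. *)
Definition au_val n (u : K n) : B n := scalar B n (au_scal u) + of_sub (au_part u).

Lemma of_sub_tr m n (a : N m) : of_sub (tr n a) = tr n (of_sub a) :> B n.
Proof.
by rewrite /tr; case: eqP => [E|_]; [case: _ / E | exact: of_sub0].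
Qed.

Lemma au_valL n c (u v : K n) : au_val (c *: u + v) = c *: au_val u + au_val v.
Proof.
by rewrite /au_val au_scalL au_partL of_subL scalarL scalerDr addrACA.
Qed.

Lemma au_valM m n p (h : m + n = p) (u : K m) (v : K n) :
  au_val (dgmul h u v) = dgmul h (au_val u) (au_val v).
Proof.
have u0 := au_scal0 u; have v0 := au_scal0 v.
rewrite /au_val mulDl !mulDr !scalar_mull //.
rewrite (scalar_mulr h (of_sub (au_part u)) v0).
rewrite [au_scal (dgmul h u v)]au_scalM [au_part (dgmul h u v)]au_partM.
rewrite !of_subD !of_subZ !of_sub_tr -!addrA; congr (_ + _).
rewrite /scalar -!scalerA.
have [m0|/eqP m0] := eqVneq m 0; last by rewrite u0 // !scale0r.
have [n0|/eqP n0] := eqVneq n 0; last by rewrite (v0 n0) !scale0r tr0.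
by rewrite trZ tr_tr.
Qed.

Lemma au_vald m n (h : m = n + 1) (u : K m) :
  au_val (dgdiff h u) = dgdiff h (au_val u).
Proof.
rewrite /au_val diffD scalar_diff [au_scal (dgdiff h u)]au_scald scalar0.
by rewrite [au_part (dgdiff h u)]au_partd.
Qed.

Lemma au_val1 : au_val (dgone K) = dgone B.
Proof.
rewrite /au_val (_ : au_scal (dgone K) = 1) // scalar0c scale1r.
by rewrite (_ : au_part (dgone K) = 0) // of_sub0 addr0.
Qed.

Lemma au_val_inj n (u v : K n) :
  au_scal u = au_scal v -> au_val u = au_val v -> u = v.
Proof.
move=> suv; rewrite /au_val suv => /addrI uv.
by apply: au_eq => //; apply: of_sub_inj.
Qed.

Lemma au_mkP n c (x : B n) (h0 : n <> 0 -> c = 0) (hS : S n (x - scalar B n c)) :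
  au_sub N n (c, to_sub hS).
Proof. by []. Qed.

Definition au_mk n c (x : B n) (h0 : n <> 0 -> c = 0)
  (hS : S n (x - scalar B n c)) : K n := to_sub (au_mkP h0 hS).

Lemma au_mk_scal n c (x : B n) h0 hS : au_scal (@au_mk n c x h0 hS) = c.
Proof. by []. Qed.

Lemma au_mk_val n c (x : B n) h0 hS : au_val (@au_mk n c x h0 hS) = x.
Proof. by rewrite /au_val au_mk_scal addrC subrK. Qed.

Lemma au_part_sub_cont n : continuous (fun u : K n => of_sub (au_part u)).
Proof. exact: comp_continuous (@au_part_cont _ N n) (@of_sub_cont _ _ (S n)). Qed.

Section Into.
Hypothesis cB : scalar_add_continuous B.

Lemma au_val_cont n : continuous (@au_val n).
Proof. by apply: cB; [exact: au_scal_cont | exact: au_part_sub_cont]. Qed.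

Lemma au_val_initial n (X : topologicalType) (f : X -> K n) :
  continuous (fun x => au_scal (f x) : discrete_topology k) ->
  continuous (fun x => au_val (f x)) -> continuous f.
Proof.
move=> cs cv; apply: to_au_continuous => //; apply: subm_continuous.
rewrite (_ : (fun x => _) = (fun x => scalar B n (- au_scal (f x)) + au_val (f x))).
  apply: cB => //.
  exact: (@all_open_continuous1 _ (discrete_topology k) (discrete_topology k)
           (fun c => - (c : k)) _ (@discrete_all_open k) cs).
apply: functional_extensionality_dep => x.
by rewrite /au_val /scalar scaleNr addKr.
Qed.

Definition au_hom : dghom K B.
Proof.
refine (@DgHom k K B au_val _ au_val1 au_valM au_vald au_val_cont).
by move=> n c u v; exact: au_valL.
Defined.

Section Factor.
Variables (C : dga k) (f : dghom C B) (e : forall n, C n -> discrete_topology k).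
Hypotheses (he : is_char e)
  (ed : forall m n (h : m = n + 1) (a : C m), e (dgdiff h a) = 0)
  (fS : forall n (a : C n), S n (f n a - scalar B n (e a))).

Definition au_lift n (a : C n) : K n := au_mk (@char_deg _ _ _ he n a) (fS a).

Lemma au_lift_val n (a : C n) : au_val (au_lift a) = f n a.
Proof. exact: au_mk_val. Qed.

(** The universal property of the algebra obtained by adjoining a unit: a morphism
    to B factors through it as soon as its values lie in S after subtraction of a
    character that vanishes on boundaries. *)
Definition au_factor : dghom C K.
Proof.
refine (@DgHom k C K au_lift _ _ _ _ _).
- move=> n c a b; apply: au_val_inj.
    by rewrite au_scalL !au_mk_scal (charL he).
  by rewrite au_valL !au_lift_val homL.
- apply: au_val_inj; first by rewrite au_mk_scal (char1 he).
  by rewrite au_lift_val hom1 au_val1.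
- move=> m n p h a b; apply: au_val_inj.
    by rewrite [RHS]au_scalM !au_mk_scal (charM he).
  by rewrite au_valM !au_lift_val homM.
- move=> m n h a; apply: au_val_inj.
    by rewrite [RHS]au_scald au_mk_scal ed.
  by rewrite au_vald !au_lift_val homd.
- move=> n; apply: au_val_initial; first exact: (char_cont he).
  rewrite (_ : (fun x => _) = f n); first exact: hom_cont.
  by apply: functional_extensionality_dep => x; rewrite au_lift_val.
Defined.

Lemma au_factor_scal n (a : C n) : au_scal (au_factor n a) = e a.
Proof. by []. Qed.

Lemma au_factor_val n (a : C n) : au_val (au_factor n a) = f n a.
Proof. exact: au_mk_val. Qed.

End Factor.
End Into.

Lemma au_scal_char : is_char (fun n (u : K n) => au_scal u : discrete_topology k).
Proof.
split.
- by move=> n c u v; exact: au_scalL.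
- exact: erefl.
- by move=> n u; exact: au_scal0.
- by move=> *; exact: au_scalM.
- exact: au_scal_cont.
Qed.

(** If v is inverse to 1 + a with a in S, then v - 1 = - a v lies in S. *)
Lemma au_scal_aug :
  graded_ideal (fun n => S n : set (B n)) ->
  (forall a : B 0, S 0 a -> is_unit (dgone B + a)) ->
  is_aug (fun n (u : K n) => au_scal u : discrete_topology k).
Proof.
move=> hS Su; split; first exact: au_scal_char.
move=> u /eqP c0; set c := au_scal u in c0.
pose a : B 0 := of_sub (au_part u).
have Sa : S 0 a by exact: of_subP.
have [v av] := Su _ (idealZ hS c^-1 Sa).
have uE : au_val u = c *: (dgone B + c^-1 *: a).
  by rewrite /au_val scalar0c scalerDr scalerA mulfV // scale1r.
have vS : S 0 (c^-1 *: v - scalar B 0 c^-1).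
  rewrite scalar0c -scalerBr; apply: (idealZ hS).
  rewrite -[v](mul1 deg00) -[X in _ - X]av mulDl opprD addNKr -sub0r.
  by apply: (idealB hS (ideal0 hS 0)); apply: (idealMr hS); exact: (idealZ hS).
exists (au_mk (fun h : (0 : int) <> 0 => match h erefl with end) vS).
apply: au_val_inj.
  by rewrite [LHS]au_scalM au_mk_scal mulfV.
by rewrite au_valM au_mk_val au_val1 uE mulZl mulZr scalerA mulfV // scale1r.
Qed.

End AdjoinUnitOfSub.

(** * Finite-dimensional algebras *)

(** Among the finite families in V, choose one for which the matrix of coordinates
    of its image in W has maximal rank. Every further row of coordinates is a
    combination of the rows of that matrix. *)
Lemma spanned_inj (k : fieldType) (V W : lmodType k) (f : {linear V -> W}) :
  injective f -> spanned W -> spanned V.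
Proof.
move=> fI [r [w sp]].
pose comb (c : 'I_r -> k) := \sum_j c j *: w j.
pose P rho := `[< exists m (N : 'M[k]_(m, r)),
  \rank N = rho /\ forall i, exists v, f v = comb (N i) >].
have exP : exists rho, P rho.
  by exists (\rank (0 : 'M[k]_(0, r))); apply/asboolP; exists 0%N, 0; split=> // -[].
have bndP rho : P rho -> (rho <= r)%N.
  by move=> /asboolP[m [N [<- _]]]; exact: rank_leq_col.
case: (ex_maxnP exP bndP) => rho /asboolP[m [N [rN fN]]] rho_max.
have /choice[v fv] := fN.
exists m, v => a; have [c fa] := sp (f a).
pose R := \row_j c j.
have : P (\rank (col_mx N R)).
  apply/asboolP; exists (m + 1)%N, (col_mx N R); split=> // i.
  case: (split_ordP i) => j ->.
    by exists (v j); rewrite fv; apply: eq_bigr => l _; rewrite col_mxEu.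
  by exists a; rewrite fa; apply: eq_bigr => l _; rewrite col_mxEd mxE.
move=> /rho_max; rewrite -rN => le_rank.
have sub : (N <= col_mx N R)%MS by rewrite -addsmxE addsmxSl.
have : (R <= N)%MS.
  have /eqmxP/eqmx_sym eqNR : (N == col_mx N R)%MS.
    by rewrite -(mxrank_leqif_eq sub) eqn_leq le_rank mxrankS.
  by rewrite -eqNR -addsmxE addsmxSr.
case/submxP => D RE; exists (D 0); apply: fI; rewrite fa linear_sum /=.
under [RHS]eq_bigr => i _ do rewrite linearZ /= fv /comb scaler_sumr.
rewrite exchange_big /=; apply: eq_bigr => j _.
under eq_bigr => i _ do rewrite scalerA.
rewrite -scaler_suml; congr (_ *: _).
by have := congr1 (fun M : 'rV_r => M 0 j) RE; rewrite !mxE.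
Qed.

Lemma spanned_prod (k : fieldType) (W : lmodType k) :
  spanned W -> spanned (k^o * W)%type.
Proof.
case=> r [w sp].
exists r.+1, (fun i => if unlift ord0 i is Some j then (0, w j) else (1, 0)).
move=> [c x]; have [d ->] := sp x.
exists (fun i => if unlift ord0 i is Some j then d j else c).
rewrite big_ord_recl unlift_none.
under [X in _ = _ + X]eq_bigr => i _ do rewrite liftK.
rewrite [c *: _](_ : _ = (c, 0)); last by congr pair; rewrite ?scaler0 //; exact: mulr1.
rewrite (_ : \sum_i _ = (0, \sum_i d i *: w i)).
  by congr pair; rewrite ?addr0 ?add0r.
elim/big_rec2: _ => // i y1 y2 _ ->; congr pair => /=; by rewrite scaler0 addr0.
Qed.

Lemma all_openP (T : topologicalType) :
  (forall x : T, \forall z \near x, z = x) -> all_open T.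
Proof.
move=> h U; rewrite openE => x Ux; rewrite /interior.
by apply: filterS (h x) => z ->.
Qed.

Section AdjoinUnitFinite.
Variables (k : fieldType) (B : dga k) (S : dgsub B).
Local Notation K := (adjoin_unit (sub_nudga S)).

Lemma adjoin_unit_finite : finite_dim B -> finite_dim K.
Proof.
move=> [[N big] sp]; split.
  exists N => n Nn u; have n0 : n <> 0 by lia.
  apply: au_eq; first by rewrite !au_scal0.
  apply: of_sub_inj; transitivity (0 : B n); first exact: big.
  by symmetry; exact: big.
move=> n; pose f (u : K n) : (k^o * B n)%type := (au_scal u, of_sub (au_part u)).
have f_lin : linear f.
  by move=> c u v; congr pair.
pose F : {linear K n -> (k^o * B n)%type} :=
  HB.pack f (GRing.isLinear.Build _ _ _ _ f f_lin).
apply: (@spanned_inj k (K n) (k^o * B n)%type F); last exact: spanned_prod (sp n).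
by move=> u v [E1 E2]; apply: au_eq => //; exact: of_sub_inj.
Qed.

Lemma adjoin_unit_discrete : is_discrete B -> is_discrete K.
Proof.
move=> dB n; apply: all_openP => u.
apply: filterS2
  (near_all_open u (@discrete_all_open k) (@au_scal_cont _ (sub_nudga S) n))
  (near_all_open u (@dB n) (@au_part_sub_cont _ _ S n)) => v Es Ep.
by apply: au_eq => //; exact: of_sub_inj.
Qed.

End AdjoinUnitFinite.

Section GroundField.
Variable k : fieldType.

Definition ground_sub (n : int) : submod (TopLmodule.clone k (discrete_topology k) _).
Proof.
refine (@Submod k (TopLmodule.clone k (discrete_topology k) _)
          (fun c => n <> 0 -> c = 0) _ _) => //.
by move=> c a b a0 b0 n0; rewrite a0 // b0 // scaler0 addr0.
Defined.

Lemma ground_mulP m n p (h : m + n = p) (a : subm (ground_sub m))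
    (b : subm (ground_sub n)) :
  ground_sub p ((of_sub a : k) * (of_sub b : k)).
Proof.
move=> p0; have [m0|/eqP m0] := eqVneq m 0; last by rewrite (of_subP a m0) mul0r.
by rewrite (of_subP b) ?mulr0 //; lia.
Qed.

Definition ground_nudga : nudga k.
Proof.
refine (@NuDga k (fun n => subm (ground_sub n))
  (fun m n p h a b => to_sub (ground_mulP h a b)) (fun _ _ _ _ => 0) _ _ _ _ _ _).
- move=> m n p h b c a a'; apply: of_sub_inj; rewrite [RHS]of_subL.
  change ((of_sub (c *: a + a') : k) * of_sub b =
            c * (of_sub a * of_sub b) + of_sub a' * of_sub b).
  by rewrite of_subL mulrDl -mulrA.
- by move=> *; apply: of_sub_inj; apply: esym; exact: mulrA.
- move=> m n p h h' a b; apply: of_sub_inj; rewrite [RHS]of_subZ.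
  change ((of_sub a : k) * of_sub b = sgn k (m * n) * (of_sub b * of_sub a)).
  have [m0|/eqP m0] := eqVneq m 0; last first.
    by rewrite (of_subP a m0) mul0r !mulr0.
  by have -> : sgn k (m * n) = 1; [rewrite m0 mul0r sgn0 | rewrite mul1r mulrC].
- by move=> m n h c a b; rewrite scaler0 addr0.
- by [].
- move=> m n p m' n' p' h hm hn hp h1 h2 a b; apply: of_sub_inj.
  rewrite [LHS]of_sub0 [RHS]of_subD [X in _ + X]of_subZ.
  change (0 = (of_sub (0 : subm (ground_sub m')) : k) * of_sub b +
     sgn k m * (of_sub a * of_sub (0 : subm (ground_sub n')))).
  by rewrite !of_sub0 mul0r !mulr0 addr0.
Defined.

Lemma ground_oneP : ground_sub 0 (1 : k). Proof. by []. Qed.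

(** The field k, concentrated in degree 0. *)
Definition ground : dga k.
Proof.
refine (@Dga k ground_nudga (to_sub ground_oneP) _).
by move=> m h a; apply: of_sub_inj; exact: mul1r.
Defined.

Lemma ground_finite : finite_dim ground.
Proof.
split.
  exists 0%N => n n0 a; apply: of_sub_inj; rewrite of_sub0.
  by apply: (of_subP a); lia.
move=> n; pose f (u : ground n) : k^o := of_sub u.
have f_lin : linear f by move=> c u v; exact: (@of_subL _ _ (ground_sub n) c u v).
pose F : {linear ground n -> k^o} := HB.pack f (GRing.isLinear.Build _ _ _ _ f f_lin).
apply: (@spanned_inj k (ground n) k^o F); first exact: of_sub_inj.
exists 1%N, (fun _ => 1) => c; exists (fun _ => c).
by rewrite big_ord1; apply: esym; exact: mulr1.
Qed.

Lemma ground_discrete : is_discrete ground.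
Proof.
move=> n; apply: (@inj_all_open _ (discrete_topology k) (@of_sub _ _ (ground_sub n))).
- exact: discrete_all_open.
- exact: of_sub_cont.
- exact: of_sub_inj.
Qed.

Section Augmentation.
Variables (C : dga k) (e : forall n, C n -> discrete_topology k).
Hypotheses (he : is_char e)
  (ed : forall m n (h : m = n + 1) (a : C m), e (dgdiff h a) = 0).

Lemma ground_augP n (a : C n) : ground_sub n (e a).
Proof. exact: (char_deg he). Qed.

Definition ground_aug : dghom C ground.
Proof.
refine (@DgHom k C ground (fun n a => to_sub (ground_augP a)) _ _ _ _ _).
- by move=> n c a b; apply: of_sub_inj; rewrite of_subL; exact: (charL he).
- by apply: of_sub_inj; exact: (char1 he).
- by move=> m n p h a b; apply: of_sub_inj; exact: (charM he).
- by move=> m n h a; apply: of_sub_inj; rewrite of_sub0; exact: ed.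
- by move=> n; apply: subm_continuous; exact: (char_cont he).
Defined.

End Augmentation.
End GroundField.

Lemma discrete_scalar_add (k : fieldType) (D : dga k) :
  is_discrete D -> scalar_add_continuous D.
Proof.
move=> dD n X c f cc cf.
exact: (@all_open_continuous2 _ (discrete_topology k) _ (D n)
          (fun c x => scalar D n (c : k) + x) c f (@discrete_all_open k) (@dD n) cc cf).
Qed.

Lemma initial_scalar_add (k : fieldType) (I : Type) (A : dga k) (D : I -> dga k)
    (pr : forall i, dghom A (D i)) :
  initial_family pr -> (forall i, scalar_add_continuous (D i)) ->
  scalar_add_continuous A.
Proof.
move=> ini cD n X c f cc cf; apply: ini => i.
rewrite (_ : (fun x => _) = (fun x => scalar (D i) n (c x) + pr i n (f x))).
  by apply: cD => //; apply: comp_continuous cf _; exact: hom_cont.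
by apply: functional_extensionality_dep => x; rewrite homD hom_scalar.
Qed.

Lemma pc_scalar_add (k : fieldType) (A : dga k) :
  pseudo_compact A -> scalar_add_continuous A.
Proof.
case=> I [Q [D [phi [pr [fd [_ _ /initial_familyP ini]]]]]].
by apply: initial_scalar_add ini _ => i; apply: discrete_scalar_add; case: (fd i).
Qed.

(** * Products of local algebras and their radicals *)

Section Morphisms.
Variable k : fieldType.

Definition hom_comp (A B C : dga k) (g : dghom B C) (f : dghom A B) : dghom A C.
Proof.
refine (@DgHom k A C (fun n a => g n (f n a)) _ _ _ _ _).
- by move=> n c a b; rewrite !homL.
- by rewrite !hom1.
- by move=> *; rewrite !homM.
- by move=> *; rewrite !homd.
- by move=> n; apply: comp_continuous; exact: hom_cont.
Defined.

Definition hom_id (A : dga k) : dghom A A.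
Proof.
refine (@DgHom k A A (fun n a => a) _ _ _ _ _) => //.
by move=> n x; exact: cvg_id.
Defined.

Definition image_dgsub (A B : dga k) (f : dghom A B) (S : dgsub A) : dgsub B.
Proof.
unshelve refine (@DgSub k B (fun n => @Submod k (B n)
  (fun b => exists2 a, S n a & f n a = b) _ _) _ _).
- by exists 0; [exact: sm0 | exact: hom0].
- move=> c _ _ [a Sa <-] [b Sb <-]; exists (c *: a + b); last exact: homL.
  exact: smP.
- move=> m n p e _ _ [a Sa <-] [b Sb <-]; exists (dgmul e a b); last exact: homM.
  exact: dsM.
- move=> m n e _ [a Sa <-]; exists (dgdiff e a); last exact: homd.
  exact: dsd.
Defined.

End Morphisms.

Section Product.
Variables (k : fieldType) (I : Type) (D : I -> dga k) (A : dga k)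
  (p : forall i, dghom A (D i)).
Hypothesis prod : is_product p.

Lemma prod_inj n (a b : A n) : (forall i, p i n a = p i n b) -> a = b.
Proof.
move=> ab; have [_ lim _] := prod.
have [|c [_ cU]] := lim n (fun i => p i n b); first by move=> ? ? [].
by rewrite -(cU a) // (cU b).
Qed.

Lemma prod_ex n (x : forall i, D i n) : exists a : A n, forall i, p i n a = x i.
Proof.
by have [_ lim _] := prod; have [|a [ax _]] := lim n x; [move=> ? ? [] | exists a].
Qed.

Lemma prod_initial : initial_family p.
Proof. by apply/initial_familyP; case: prod. Qed.

Lemma prod_hom (C : dga k) (f : forall i, dghom C (D i)) :
  exists g : dghom C A, forall i n (c : C n), p i n (g n c) = f i n c.
Proof.
pose g n (c : C n) : A n := sval (cid (prod_ex (fun i => f i n c))).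
have gE n (c : C n) i : p i n (g n c) = f i n c.
  exact: svalP (cid (prod_ex (fun i => f i n c))) i.
unshelve eexists (@DgHom k C A g _ _ _ _ _); last by move=> i n c; exact: gE.
- by move=> n c a b; apply: prod_inj => i; rewrite homL !gE homL.
- by apply: prod_inj => i; rewrite gE !hom1.
- by move=> *; apply: prod_inj => i; rewrite homM !gE homM.
- by move=> *; apply: prod_inj => i; rewrite homd !gE homd.
- move=> n; apply: prod_initial => i.
  rewrite (_ : (fun x => _) = f i n); first exact: hom_cont.
  by apply: functional_extensionality_dep => x; exact: gE.
Qed.

Lemma prod_unit (a : A 0) : (forall i, is_unit (p i 0 a)) -> is_unit a.
Proof.
move=> ua; have [v vE] := prod_ex (fun i => sval (cid (ua i))).
exists v; apply: prod_inj => i; rewrite homM vE hom1; exact: svalP (cid (ua i)).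
Qed.

End Product.

(** A local algebra is a product with one factor, so that results on products
    apply to it. *)
Lemma self_product (k : fieldType) (A : dga k) :
  is_product (fun _ : unit => hom_id A).
Proof.
split; first by move=> i j [].
  move=> n x _; exists (x tt); split=> [[] //|a ax]; exact: esym (ax tt).
by apply/initial_familyP => n X f; apply; exact: tt.
Qed.

Section Radicals.
Variables (k : fieldType) (B : dga k).

Definition sum_gset (I J : gset B) : gset B :=
  fun n => [set a | exists x y, [/\ I n x, J n y & a = x + y]].

Lemma sum_ideal (I J : gset B) :
  graded_ideal I -> graded_ideal J -> graded_ideal (sum_gset I J).
Proof.
move=> hI hJ; split.
- move=> n; exists 0, 0; rewrite addr0.
  by split=> //; [exact: (ideal0 hI) | exact: (ideal0 hJ)].
- move=> n c _ _ [x [y [Ix Jy ->]]] [x' [y' [Ix' Jy' ->]]].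
  exists (c *: x + x'), (c *: y + y'); rewrite scalerDr addrACA.
  by split=> //; [exact: (idealL hI) | exact: (idealL hJ)].
- move=> m n p e a _ [x [y [Ix Jy ->]]].
  exists (dgmul e a x), (dgmul e a y); rewrite mulDr.
  by split=> //; [exact: (idealMl hI) | exact: (idealMl hJ)].
Qed.

Lemma sum_diff_closed (I J : gset B) :
  diff_closed I -> diff_closed J -> diff_closed (sum_gset I J).
Proof.
move=> dI dJ m n e _ [x [y [Ix Jy ->]]].
exists (dgdiff e x), (dgdiff e y); rewrite diffD.
by split=> //; [exact: dI | exact: dJ].
Qed.

(** The usual description of the Jacobson radical: if 1 + N consists of units
    and I does not contain N, then I + N is the unit ideal, so that I contains a
    unit 1 - y with y in N. The predicate P is that of being an ideal, or a
    differential ideal. *)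
Lemma sub_maximal (P : gset B -> Prop) (I N : gset B) :
  P I -> (forall J, P J -> graded_ideal J) -> P (sum_gset I N) ->
  maximal_among P I -> graded_ideal N ->
  (forall a : B 0, N 0 a -> is_unit (dgone B + a)) -> gset_le N I.
Proof.
move=> PI Pid PIN [_ pI maxI] hN Nu.
have hI := Pid _ PI.
have II : gset_le I (sum_gset I N).
  by move=> n x Ix; exists x, 0; rewrite addr0; split=> //; exact: (ideal0 hN).
have pIN : proper_gset (sum_gset I N).
  apply/(properP (Pid _ PIN)) => -[x [y [Ix Ny E]]].
  move/(properP hI): pI; apply; apply: (ideal_unit hI) Ix.
  have -> : x = dgone B - y by rewrite E addrK.
  by rewrite -scaleN1r; apply: Nu; exact: (idealZ hN).
move=> n a Na; apply: (maxI _ PIN pIN II); exists 0, a; rewrite add0r.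
by split=> //; exact: (ideal0 hI).
Qed.

End Radicals.

Section LocalPieces.
Variable k : closedFieldType.

Definition aug (P : locpc k) : forall n, P n -> discrete_topology k :=
  sval (cid (locpc_aug P)).

Lemma aug_is_aug (P : locpc k) : is_aug (@aug P).
Proof. by have [] := svalP (cid (locpc_aug P)). Qed.

Lemma augP (P : locpc k) n (a : P n) : maximal_ideal a <-> aug a = 0.
Proof. by have [_ h] := svalP (cid (locpc_aug P)); exact: h. Qed.

(** The largest proper differential ideal of a local algebra. *)
Definition diff_max (P : locpc k) : gset P := fun n =>
  [set a | aug a = 0 /\ forall m (e : n = m + 1), aug (dgdiff e a) = 0].

Lemma diff_max_ideal (P : locpc k) : graded_diff_ideal (@diff_max P).
Proof.
have hP := aug_is_aug P.
split; last by move=> m n e a [a0 da]; split=> [|q e']; rewrite ?diffK ?(aug0 hP).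
split.
- by move=> n; split=> [|m e]; rewrite ?diff0 (aug0 hP).
- move=> n c a b [a0 da] [b0 db]; split=> [|m e].
    by rewrite (charL hP) a0 b0 mulr0 addr0.
  by rewrite diffL (charL hP) da db mulr0 addr0.
- move=> m n p e a b [b0 db]; split=> [|q ep].
    by rewrite (charM hP) b0 mulr0.
  have em : m = (m - 1) + 1 by lia.
  have en : n = (n - 1) + 1 by lia.
  have e1 : (m - 1) + n = q by lia.
  have e2 : m + (n - 1) = q by lia.
  rewrite (leibniz e em en ep e1 e2) (augD hP) (augZ hP) !(charM hP) b0 db.
  by rewrite !mulr0 addr0.
Qed.

Lemma aug_unit1D (P : locpc k) (a : P 0) : aug a = 0 -> is_unit (dgone P + a).
Proof.
move=> a0; apply: (aug_unit (aug_is_aug P)).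
rewrite (augD (aug_is_aug P)) (char1 (aug_is_aug P)) a0 addr0.
by apply/eqP; exact: oner_neq0.
Qed.

End LocalPieces.

Section DJac.
Variables (k : closedFieldType) (I : Type) (A_ : I -> locpc k) (A : dga k)
  (p : forall i, dghom A (A_ i)).
Hypothesis prod : is_product p.

Definition prod_diff_max : gset A := fun n => [set a | forall i, diff_max (p i n a)].

Lemma prod_diff_max_ideal : graded_diff_ideal prod_diff_max.
Proof.
split; last first.
  by move=> m n e a ha i; rewrite homd; have [_ hd] := diff_max_ideal (A_ i); exact: hd.
split=> [n i|n c a b ha hb i|m n q e a b hb i]; have [hI _] := diff_max_ideal (A_ i).
- by rewrite hom0; exact: (ideal0 hI).
- by rewrite homL; exact: (idealL hI).
- by rewrite homM; exact: (idealMl hI).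
Qed.

Lemma prod_diff_max_unit (a : A 0) : prod_diff_max a -> is_unit (dgone A + a).
Proof.
move=> ha; apply: (prod_unit prod) => i; rewrite homD hom1.
by apply: aug_unit1D; case: (ha i).
Qed.

(** If J properly contained the pull-back of the largest differential ideal of
    a factor, it would contain an element with nonzero augmentation c there,
    namely an element of J or its boundary. That element has degree 0, and modulo
    the pull-back it is the scalar c, since its boundary has degree -1 and
    therefore zero augmentation; so J would contain 1. *)
Lemma pullback_diff_max (i : I) :
  max_diff_ideal (fun n => [set a : A n | diff_max (p i n a)]).
Proof.
have [hI hd] := diff_max_ideal (A_ i); have he := aug_is_aug (A_ i).
split.
- split; first exact: (preimage_ideal (p i) hI).
  by move=> m n e a ha; rewrite /= homd; exact: hd.
- exists 0, (dgone A); rewrite /= hom1 => -[+ _].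
  by rewrite (char1 he); apply/eqP; exact: oner_neq0.
move=> J [hJ dJ] /(properP hJ) pJ NJ.
have J0 n (b : A n) : J n b -> aug (p i n b) = 0.
  move=> Jb; apply: contrapT => c0.
  have [n0|/eqP n0] := eqVneq n 0; last by apply: c0; exact: (char_deg he).
  subst n; apply: pJ; set c := aug _ in c0.
  have Nb : diff_max (p i 0 (b - c *: dgone A)).
    rewrite homB homZ hom1; split=> [|m e].
      by rewrite (augB he) (augZ he) (char1 he) mulr1 subrr.
    by rewrite (char_deg he) //; lia.
  have := idealZ hJ c^-1 (idealB hJ Jb (NJ _ _ Nb)).
  by rewrite subKr scalerA mulVf ?scale1r //; exact/eqP.
move=> n a Ja; split=> [|m e]; first exact: J0.
by rewrite -homd; apply: J0; exact: dJ.
Qed.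

(** Maximal differential ideals of an infinite product need not be pulled back
    from a factor, but they all contain [prod_diff_max], since 1 plus an element of
    that ideal is a unit. *)
Lemma dJacE : dJac (A := A) = prod_diff_max.
Proof.
apply: functional_extensionality_dep => n; apply/seteqP; split=> a.
  by move=> ha i; exact: (ha _ (pullback_diff_max i)).
move=> ha M hM; have [PM _ _] := hM.
have [hN dN] := prod_diff_max_ideal.
apply: (sub_maximal PM _ _ hM hN) ha => [J [] //||]; last exact: prod_diff_max_unit.
case: PM => PM1 PM2.
by split; [exact: sum_ideal | exact: sum_diff_closed].
Qed.

End DJac.

(** * Pseudo-compactness of the algebra obtained from the differential radical *)

Record presentation (k : fieldType) (A : dga k) := Presentation {
  pr_idx : Type;
  pr_arrow : pr_idx -> pr_idx -> Type;
  pr_node : pr_idx -> dga k;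
  pr_map : forall i j, pr_arrow i j -> dghom (pr_node i) (pr_node j);
  pr_proj : forall i, dghom A (pr_node i);
  pr_fin : forall i, finite_dim (pr_node i) /\ is_discrete (pr_node i);
  pr_limit : is_limit pr_map pr_proj
}.

Arguments pr_idx {k A} _.
Arguments pr_arrow {k A} _ _ _.
Arguments pr_node {k A} _ _.
Arguments pr_map {k A} _ {i j} _.
Arguments pr_proj {k A} _ _.
Arguments pr_fin {k A} _ _.
Arguments pr_limit {k A} _.

Definition pc_presentation (k : fieldType) (A : dga k) (pcA : pseudo_compact A) :
  presentation A.
Proof.
apply: (@sval _ (fun _ => True)); apply: cid.
have [I [Q [D [phi [pr [fin lim]]]]]] := pcA.
by exists (Presentation fin lim).
Qed.

(** A node in which 1 is nonzero: its kernel is a proper ideal. *)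
Lemma kernel_node (k : closedFieldType) (P : locpc k) (X : presentation P) :
  exists i, forall n (a : P n), pr_proj X i n a = 0 -> aug a = 0.
Proof.
have he := aug_is_aug P.
have [i Di] : exists i, dgone (pr_node X i) <> 0.
  apply: limit_one_neq0 (pr_limit X) _ => /(congr1 (@aug k P 0)).
  by rewrite (char1 he) (aug0 he) => /eqP; rewrite oner_eq0.
exists i => n a a0.
apply: (sub_aug_ker he (kernel_ideal (pr_proj X i))) a0.
by exists 0, (dgone P); rewrite /= hom1.
Qed.

Definition diff_max_dgsub (k : closedFieldType) (P : locpc k) : dgsub P :=
  ideal_dgsub (diff_max_ideal P).

Section PseudoCompact.
Variables (k : closedFieldType) (I : Type) (A_ : I -> locpc k) (A : dga k)
  (p : forall i, dghom A (A_ i)).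
Hypothesis prod : is_product p.

Let S : dgsub A := ideal_dgsub (dJac_ideal A).
Local Notation K := (k_dJac A).

Lemma dJac_diff_max n (a : A n) : S n a <-> forall i, diff_max (p i n a).
Proof. by change (S n a) with (dJac a); rewrite (dJacE prod). Qed.

Lemma product_scalar_add : scalar_add_continuous A.
Proof.
apply: initial_scalar_add (prod_initial prod) _ => i.
exact: pc_scalar_add (pc_pc (A_ i)).
Qed.

Lemma dJac_aug : is_aug (fun n (u : K n) => au_scal u : discrete_topology k).
Proof.
apply: (@au_scal_aug k A S); first by case: (dJac_ideal A).
by move=> a /dJac_diff_max; exact: prod_diff_max_unit.
Qed.

Let X i := pc_presentation (pc_pc (A_ i)).
Let i0 i := sval (cid (kernel_node (X i))).
Let T i : dgsub (pr_node (X i) (i0 i)) :=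
  image_dgsub (pr_proj (X i) (i0 i)) (diff_max_dgsub (A_ i)).

Lemma kernel_diff_max i n (a : A_ i n) :
  pr_proj (X i) (i0 i) n a = 0 -> diff_max a.
Proof.
have ker := svalP (cid (kernel_node (X i))) => a0.
split=> [|m e]; first exact: ker.
by apply: ker; rewrite homd a0 diff0.
Qed.

(** The algebra k (+) dJac(A) as a limit. Besides the nodes of the A_i there is,
    for each i, the algebra k (+) T_i, where T_i is the image of the largest
    differential ideal of A_i in the node [i0 i]. Its arrow to that node forces the
    component in A_i to be a scalar plus an element of the differential ideal, the
    kernel of the projection being contained in that ideal. Its arrow to k forces
    the scalars of the various components to agree. *)
Inductive node : Type := Ground | Unital of I | Node i of pr_idx (X i).

Inductive arrow : node -> node -> Type :=
| ToGround i : arrow (Unital i) Ground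
| Inclusion i : arrow (Unital i) (Node (i0 i))
| Arrow i j j' : pr_arrow (X i) j j' -> arrow (@Node i j) (@Node i j').

Definition node_dga (x : node) : dga k :=
  match x with
  | Ground => ground k
  | Unital i => adjoin_unit (sub_nudga (@T i))
  | Node i j => pr_node (X i) j
  end.

Lemma node_fin x : finite_dim (node_dga x) /\ is_discrete (node_dga x).
Proof.
case: x => [|i|i j] /=.
- by split; [exact: ground_finite | exact: ground_discrete].
- have [fD dD] := pr_fin (X i) (i0 i).
  by split; [exact: adjoin_unit_finite | exact: adjoin_unit_discrete].
- exact: (pr_fin (X i)).
Qed.

Definition node_map x y (u : arrow x y) : dghom (node_dga x) (node_dga y) :=
  match u with
  | ToGround i => ground_aug (au_scal_char (@T i)) (fun _ _ _ _ => erefl)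
  | Inclusion i => au_hom (@T i) (discrete_scalar_add (pr_fin (X i) (i0 i)).2)
  | Arrow i j j' v => pr_map (X i) v
  end.

Lemma unital_projP i n (u : K n) :
  T i n (hom_comp (hom_comp (pr_proj (X i) (i0 i)) (p i))
            (au_hom S product_scalar_add) n u
          - scalar (pr_node (X i) (i0 i)) n (au_scal u)).
Proof.
exists (p i n (of_sub (au_part u))).
  by have /dJac_diff_max := of_subP (au_part u); apply.
by rewrite /= /au_val !homD !hom_scalar addrC addKr.
Qed.

Definition node_proj x : dghom K (node_dga x) :=
  match x with
  | Ground => ground_aug (au_scal_char S) (fun _ _ _ _ => erefl)
  | Unital i => au_factor (discrete_scalar_add (pr_fin (X i) (i0 i)).2)
                  (au_scal_char S) (fun _ _ _ _ => erefl) (@unital_projP i)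
  | Node i j => hom_comp (hom_comp (pr_proj (X i) j) (p i))
                  (au_hom S product_scalar_add)
  end.

Lemma node_limit : is_limit node_map node_proj.
Proof.
split.
- move=> x y [i|i|i j j' u] n a.
  + by apply: of_sub_inj.
  + exact: au_factor_val.
  + by have [comp _ _] := pr_limit (X i); exact: comp.
- move=> n x xE.
  have c0 : ground_sub k n (of_sub (x Ground)) by exact: of_subP.
  set c : k := of_sub (x Ground) in c0.
  have limX i := pr_limit (X i).
  have yex i : exists y : A_ i n, forall j, pr_proj (X i) j n y = x (@Node i j).
    have [_ lim _] := limX i.
    have [|y [yE _]] := lim n (fun j => x (@Node i j)); last by exists y.
    by move=> j j' u; exact: (xE _ _ (Arrow u)).
  (* The limit property of each A_i only speaks of compatible families; here it
     is turned into joint injectivity of the projections. *)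
  have yU i (y y' : A_ i n) :
      (forall j, pr_proj (X i) j n y = pr_proj (X i) j n y') -> y = y'.
    move=> yy; have [comp lim _] := limX i.
    have [|z [_ zU]] := lim n (fun j => pr_proj (X i) j n y').
      by move=> j j' u; exact: comp.
    by rewrite -(zU y) // (zU y').
  have [a aE] := prod_ex prod (fun i => sval (cid (yex i))).
  have paE i j : pr_proj (X i) j n (p i n a) = x (@Node i j).
    by rewrite aE; exact: svalP (cid (yex i)) j.
  have aS : S n (a - scalar A n c).
    apply/dJac_diff_max => i; have [hI _] := diff_max_ideal (A_ i).
    have xU := xE _ _ (Inclusion i).
    have xc : au_scal (x (Unital i)) = c by rewrite /c -(xE _ _ (ToGround i)).
    have [m Sm mE] : T i n (of_sub (au_part (x (Unital i)))) by exact: of_subP.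
    rewrite homB hom_scalar -[_ - _](subrK m); apply: (idealD hI) => //.
    apply: kernel_diff_max; rewrite !homB hom_scalar paE mE.
    by rewrite -xU /= /au_val xc [X in X - _ - _]addrC addrK subrr.
  exists (au_mk c0 aS); split=> [[|i|i j]|u uE].
  + exact: of_sub_inj.
  + apply: au_val_inj.
      by rewrite au_factor_scal au_mk_scal /c -(xE _ _ (ToGround i)).
    rewrite au_factor_val /= au_mk_val paE.
    by rewrite -(xE _ _ (Inclusion i)).
  + by rewrite /= au_mk_val paE.
  + apply: au_val_inj; first by rewrite au_mk_scal /c -(uE Ground).
    rewrite au_mk_val; apply: (prod_inj prod) => i; apply: yU => j.
    by rewrite paE -(uE (@Node i j)).
- apply/initial_familyP => n Y f cf.
  apply: (au_val_initial product_scalar_add).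
    exact: (comp_continuous (cf Ground) (@of_sub_cont _ _ (ground_sub k n))).
  apply: (prod_initial prod) => i.
  have /initial_familyP ini : forall n, _ := (let: And3 _ _ h := pr_limit (X i) in h).
  by apply: ini => j; exact: (cf (@Node i j)).
Qed.

Lemma k_dJac_pc : pseudo_compact K.
Proof.
exists node, arrow, node_dga, node_map, node_proj.
by split; [exact: node_fin | exact: node_limit].
Qed.

End PseudoCompact.

(** * The universal property *)

Section Isomorphisms.
Variable k : fieldType.

Lemma iso_sym (A B : dga k) : dg_iso A B -> dg_iso B A.
Proof. by case=> f [g [gf fg]]; exists g, f. Qed.

Lemma iso_trans (A B C : dga k) : dg_iso A B -> dg_iso B C -> dg_iso A C.
Proof.
case=> f [g [gf fg]] [f' [g' [gf' fg']]].
by exists (hom_comp f' f), (hom_comp g g'); split=> n a /=; rewrite ?gf' ?gf ?fg ?fg'.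
Qed.

Lemma iso_pseudo_compact (A B : dga k) :
  dg_iso A B -> pseudo_compact B -> pseudo_compact A.
Proof.
case=> f [g [gf fg]] [I [Q [D [phi [pr [fin [comp lim /initial_familyP ini]]]]]]].
exists I, Q, D, phi, (fun i => hom_comp (pr i) f); split=> //; split.
- by move=> i j u n a; exact: comp.
- move=> n x /lim[b [bx bU]]; exists (g n b).
  split=> [i|a ax]; first by rewrite /= fg.
  by rewrite (bU (f n a)) ?gf // => i; exact: ax.
- apply/initial_familyP => n X h ch.
  have -> : h = (fun x => g n (f n (h x))).
    by apply: functional_extensionality_dep => x; rewrite gf.
  by apply: comp_continuous (@hom_cont _ _ _ g n); apply: ini.
Qed.

Lemma iso_aug (A B : dga k) (f : dghom A B) (g : dghom B A)
    (e : forall n, B n -> discrete_topology k) :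
  (forall n (a : A n), g n (f n a) = a) -> is_aug e ->
  is_aug (fun n (a : A n) => e n (f n a)).
Proof.
move=> gf he; split; first split.
- by move=> n c a b; rewrite homL (charL he).
- by rewrite hom1 (char1 he).
- by move=> n a n0; rewrite (char_deg he).
- by move=> *; rewrite homM (charM he).
- by move=> n; apply: comp_continuous (@hom_cont _ _ _ f n) (@char_cont _ _ _ he n).
- by move=> a /(aug_unit he)/(hom_unit g); rewrite gf.
Qed.

Lemma iso_hinich (A B : dga k) (e : forall n, B n -> discrete_topology k) :
  dg_iso A B -> pseudo_compact B -> is_aug e ->
  (forall m n (h : m = n + 1) (b : B m), e n (dgdiff h b) = 0) -> is_hinich A.
Proof.
move=> AB pcB he ed; have [f [g [gf fg]]] := AB.
apply: aug_hinich (iso_aug gf he) (iso_pseudo_compact AB pcB) _ => m n h a.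
by rewrite homd ed.
Qed.

End Isomorphisms.

Section SubDga.
Variables (k : fieldType) (B : dga k) (S : dgsub B) (S1 : S 0 (dgone B)).

Definition sub_incl : dghom (sub_dga S1) B.
Proof.
refine (@DgHom k (sub_dga S1) B (fun n a => of_sub a) _ _ _ _ _) => //.
by move=> n; exact: of_sub_cont.
Defined.

Definition sub_factor (C : dga k) (f : dghom C B) (fS : forall n c, S n (f n c)) :
  dghom C (sub_dga S1).
Proof.
refine (@DgHom k C (sub_dga S1) (fun n c => to_sub (fS n c)) _ _ _ _ _).
- by move=> n c a b; apply: of_sub_inj; rewrite [RHS]of_subL; exact: homL.
- by apply: of_sub_inj; exact: hom1.
- by move=> *; apply: of_sub_inj; exact: homM.
- by move=> *; apply: of_sub_inj; exact: homd.
- by move=> n; apply: subm_continuous; exact: hom_cont.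
Defined.

End SubDga.

Section HinichPart.
Variables (k : closedFieldType) (P : locpc k).
Local Notation H := (hinich_part P).

Definition hinich_aug n (a : H n) : discrete_topology k := aug (of_sub a).

Lemma hinich_char : is_char hinich_aug.
Proof.
have he := aug_is_aug P; split.
- by move=> n c a b; rewrite /hinich_aug of_subL (charL he).
- exact: (char1 he).
- by move=> n a; exact: (char_deg he).
- by move=> m n p h a b; exact: (charM he).
- by move=> n; exact: comp_continuous (@of_sub_cont _ _ _) (@char_cont _ _ _ he n).
Qed.

Lemma hinich_aug_diff m n (h : m = n + 1) (a : H m) : hinich_aug (dgdiff h a) = 0.
Proof. by apply/augP; exact: (of_subP a). Qed.

Lemma aug_sub_scalar n (a : P n) : aug (a - scalar P n (aug a)) = 0.
Proof.
have he := aug_is_aug P.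
have [n0|/eqP n0] := eqVneq n 0; last exact: (char_deg he).
by subst n; rewrite scalar0c (augB he) (augZ he) (char1 he) mulr1 subrr.
Qed.

Lemma hinich_diff_max n (a : H n) :
  diff_max (of_sub a - scalar P n (hinich_aug a)).
Proof.
split=> [|m e]; first exact: aug_sub_scalar.
by rewrite diffB scalar_diff subr0; exact: hinich_aug_diff.
Qed.

Section IntoHinich.
Variables (C : dga k) (e : forall n, C n -> discrete_topology k) (g : dghom C P).
Hypotheses (he : is_aug e)
  (ed : forall m n (h : m = n + 1) (a : C m), e (dgdiff h a) = 0).

(** Boundaries have zero augmentation in C, hence also in P. *)
Lemma into_hinichP n (c : C n) : hinich_dgsub P n (g n c).
Proof.
by move=> m h; apply/augP; rewrite -homd (hom_aug g he (aug_is_aug P)) ed.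
Qed.

Definition into_hinich : dghom C H :=
  sub_factor (hinich_dgsub1 P) into_hinichP.

End IntoHinich.

Section FromHinich.
Variables (I : Type) (A_ : I -> locpc k) (A : dga k) (p : forall i, dghom A (A_ i)).
Hypothesis prod : is_product p.
Variable f : dghom H A.
Hypothesis f_diff_max : forall n (a : H n) i,
  diff_max (p i n (f n a - scalar A n (hinich_aug a))).

Lemma from_hinichP n (a : H n) :
  ideal_dgsub (dJac_ideal A) n (f n a - scalar A n (hinich_aug a)).
Proof. exact/(dJac_diff_max prod). Qed.

Definition from_hinich : dghom H (k_dJac A) :=
  au_factor (product_scalar_add prod) hinich_char hinich_aug_diff from_hinichP.

End FromHinich.

(** Inside P, the subalgebra P^H is the sum of the scalars and of the largest
    differential ideal. *)
Lemma hinich_self : dg_iso H (k_dJac P).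
Proof.
have prod : @is_product k unit (fun _ => P) P (fun _ => hom_id P).
  exact: self_product.
have fd n (a : H n) (i : unit) : diff_max (hom_id P n
    (sub_incl (hinich_dgsub1 P) n a - scalar P n (hinich_aug a))).
  exact: hinich_diff_max.
have he := dJac_aug prod.
pose G := into_hinich (au_hom (ideal_dgsub (dJac_ideal P)) (product_scalar_add prod))
  he (fun _ _ _ _ => erefl).
exists (from_hinich prod fd), G; split=> n a.
  by apply: of_sub_inj; exact: au_factor_val.
apply: au_val_inj; last exact: au_factor_val.
by rewrite au_factor_scal; exact: (hom_aug (au_hom _ _) he (aug_is_aug P)).
Qed.

Lemma hinich_part_hinich : is_hinich H.
Proof.
have prod : @is_product k unit (fun _ => P) P (fun _ => hom_id P).
  exact: self_product.
apply: iso_hinich hinich_self (k_dJac_pc prod) (dJac_aug prod) _.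
by [].
Qed.

End HinichPart.

Lemma hom_diff_max (k : closedFieldType) (P Q : locpc k) (q : dghom P Q) n (a : P n) :
  diff_max a -> diff_max (q n a).
Proof.
have qa := hom_aug q (aug_is_aug P) (aug_is_aug Q).
by case=> a0 da; split=> [|m e]; rewrite -?homd qa.
Qed.

(** Both sides represent the functor of morphisms to A on Hinich algebras. The
    composite on P^H is identified by the uniqueness clause of the product in the
    category of local algebras, to which P^H belongs; the composite on
    k (+) dJac(A) is identified componentwise. *)
Lemma is_G_iso (k : closedFieldType) (A : pcdga k) (P : locpc k) :
  is_G A P -> dg_iso (hinich_part P) (k_dJac A) /\
    exists (I : Type) (A_ : I -> locpc k) (p : forall i, dghom A (A_ i)), is_product p.
Proof.
case=> I [A_ [p [q [prod Eprod]]]]; split; last by exists I, A_, p.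
have heK := dJac_aug prod.
pose KL := LocPc (loc_pc := PcDga (k_dJac_pc prod)) (aug_local heK).
pose val_hom : dghom (k_dJac A) A :=
  au_hom (ideal_dgsub (dJac_ideal A)) (product_scalar_add prod).
have [g [gE _]] := Eprod KL (fun i => hom_comp (p i) val_hom).
pose G : dghom (k_dJac A) (hinich_part P) :=
  into_hinich g heK (fun _ _ _ _ => erefl).
pose incl := sub_incl (hinich_dgsub1 P).
have [f fE] := prod_hom prod (fun i => hom_comp (q i) incl).
have fd n (a : hinich_part P n) i :
    diff_max (p i n (f n a - scalar A n (hinich_aug a))).
  rewrite homB fE hom_scalar /= -(hom_scalar (q i)) -homB.
  exact/hom_diff_max/hinich_diff_max.
pose F := from_hinich prod fd.
exists F, G; split=> n a; last first.
  apply: au_val_inj.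
    by rewrite au_factor_scal; exact: (hom_aug g heK (aug_is_aug P)).
  rewrite au_factor_val; apply: (prod_inj prod) => i.
  by rewrite fE; exact: gE.
apply: of_sub_inj.
have [pcH [locH _]] := hinich_part_hinich P.
pose HL := LocPc (loc_pc := PcDga pcH) locH.
have [h [_ hU]] := Eprod HL (fun i => hom_comp (q i) incl).
transitivity (h n a); last by apply/esym; apply: (hU incl).
apply: (hU (hom_comp g F)) => i m b.
rewrite [LHS]gE; change (p i m (au_val (F m b)) = q i m (incl m b)).
by rewrite au_factor_val fE.
Qed.

(** * The acyclic case *)

(** Morphisms of algebras without unit. *)
Record is_nu_hom (k : fieldType) (N N' : nudga k) (t : forall n, N n -> N' n) :
    Prop := IsNuHom {
  nu_homL : forall n c (a b : N n), t n (c *: a + b) = c *: t n a + t n b;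
  nu_homM : forall m n p (e : m + n = p) (a : N m) (b : N n),
    t p (dgmul e a b) = dgmul e (t m a) (t n b);
  nu_homd : forall m n (e : m = n + 1) (a : N m),
    t n (dgdiff e a) = dgdiff e (t m a);
  nu_hom_cont : forall n, continuous (t n)
}.

Lemma nu_hom_inverse (k : fieldType) (N N' : nudga k)
    (t : forall n, N n -> N' n) (s : forall n, N' n -> N n) :
  is_nu_hom t -> (forall n, cancel (@t n) (@s n)) -> (forall n, cancel (@s n) (@t n)) ->
  (forall n, continuous (s n)) -> is_nu_hom s.
Proof.
move=> ht ts st cs; split=> // [n c a b|m n p e a b|m n e a];
  apply: (can_inj (ts _)); rewrite st.
- by rewrite (nu_homL ht) !st.
- by rewrite (nu_homM ht) !st.
- by rewrite (nu_homd ht) st.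
Qed.

Section AdjoinUnitMap.
Variables (k : fieldType) (N N' : nudga k) (t : forall n, N n -> N' n).
Arguments t : clear implicits.
Hypothesis ht : is_nu_hom t.

Lemma nu_homD n (a b : N n) : t n (a + b) = t n a + t n b.
Proof. by rewrite -[a]scale1r (nu_homL ht) !scale1r. Qed.

Lemma nu_hom0 n : t n 0 = 0.
Proof. by apply: (addrI (t n 0)); rewrite -nu_homD !addr0. Qed.

Lemma nu_homZ n c (a : N n) : t n (c *: a) = c *: t n a.
Proof. by rewrite -[c *: a]addr0 (nu_homL ht) nu_hom0 addr0. Qed.

Lemma nu_hom_tr m n (a : N m) : t n (tr n a) = tr n (t m a).
Proof. by rewrite /tr; case: eqP => [E|_]; [case: _ / E | exact: nu_hom0]. Qed.

Lemma au_mapP n (u : adjoin_unit N n) : au_sub N' n (au_scal u, t n (au_part u)).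
Proof. exact: au_scal0. Qed.

Definition au_map : dghom (adjoin_unit N) (adjoin_unit N').
Proof.
refine (@DgHom k _ _ (fun n u => to_sub (au_mapP u) : adjoin_unit N' n) _ _ _ _ _).
- move=> n c u v; apply: au_eq; first by rewrite [RHS]au_scalL; exact: au_scalL.
  rewrite [RHS]au_partL; change (t n (au_part (c *: u + v)) =
    c *: t n (au_part u) + t n (au_part v)).
  by rewrite au_partL (nu_homL ht).
- by apply: au_eq => //; exact: nu_hom0.
- move=> m n p e u v; apply: au_eq; first by rewrite [RHS]au_scalM.
  rewrite [RHS]au_partM; change (t p (au_part (au_mul e u v)) =
    au_scal u *: tr p (t n (au_part v)) + au_scal v *: tr p (t m (au_part u))
    + dgmul e (t m (au_part u)) (t n (au_part v))).
  by rewrite au_partM !nu_homD !nu_homZ !nu_hom_tr (nu_homM ht).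
- by move=> m n e u; apply: au_eq => //; exact: (nu_homd ht).
- move=> n; apply: to_au_continuous; first exact: au_scal_cont.
  exact: comp_continuous (@au_part_cont _ N n) (@nu_hom_cont _ _ _ _ ht n).
Defined.

End AdjoinUnitMap.

Lemma adjoin_unit_iso (k : fieldType) (N N' : nudga k)
    (t : forall n, N n -> N' n) (s : forall n, N' n -> N n) :
  is_nu_hom t -> (forall n, cancel (@t n) (@s n)) -> (forall n, cancel (@s n) (@t n)) ->
  (forall n, continuous (s n)) -> dg_iso (adjoin_unit N) (adjoin_unit N').
Proof.
move=> ht ts st cs; have hs := nu_hom_inverse ht ts st cs.
exists (au_map ht), (au_map hs); split=> n u; apply: au_eq => //.
  exact: ts.
exact: st.
Qed.

(** Continuity into a pseudo-compact algebra is tested on discrete nodes, where an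
    operation that every dg morphism transports is automatically continuous. *)
Lemma pc_op_continuous (k : fieldType) (A : dga k) m n p
    (F : A m -> A n -> A p) (X : topologicalType) (u : X -> A m) (v : X -> A n) :
  pseudo_compact A ->
  (forall (D : dga k) (f : dghom A D), exists G : D m -> D n -> D p,
     forall a b, f p (F a b) = G (f m a) (f n b)) ->
  continuous u -> continuous v -> continuous (fun x => F (u x) (v x)).
Proof.
case=> I [Q [D [phi [pr [fin [_ _ /initial_familyP ini]]]]]] FG cu cv.
apply: ini => i; have [G GE] := FG _ (pr i); have [_ dD] := fin i.
have -> : (fun x => pr i p (F (u x) (v x))) =
    (fun x => G (pr i m (u x)) (pr i n (v x))).
  by apply: functional_extensionality_dep => x; rewrite GE.
apply: (@all_open_continuous2 _ _ _ _ G (fun x => pr i m (u x)) (fun x => pr i n (v x))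
         (@dD m) (@dD n)).
  by apply: comp_continuous cu _; exact: hom_cont.
by apply: comp_continuous cv _; exact: hom_cont.
Qed.

Section JacClosed.
Variables (k : closedFieldType) (I : Type) (A_ : I -> locpc k) (A : dga k)
  (p : forall i, dghom A (A_ i)).
Hypothesis prod : is_product p.
Local Notation Z := (closed_dga A).

Definition closed_incl : dghom Z A := sub_incl (S := closed_dgsub A) (diff1 A).

Definition prod_aug_ker : gset Z :=
  fun n => [set z | forall i, aug (p i n (closed_incl n z)) = 0].

Lemma prod_aug_ker_ideal : graded_ideal prod_aug_ker.
Proof.
split=> [n i|n c a b ha hb i|m n q e a b hb i]; have he := aug_is_aug (A_ i).
- by rewrite !hom0 (aug0 he).
- by rewrite !homL (charL he) ha hb mulr0 addr0.
- by rewrite !homM (charM he) hb mulr0.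
Qed.

(** If z v = 1 with z closed, then z dv = 0, so that dv = v z dv = 0. *)
Lemma closed_inverse (z : Z 0) : is_unit (closed_incl 0 z) -> is_unit z.
Proof.
case=> v zv.
have vZ : closed_dgsub A 0 v.
  move=> m e.
  have e1 : m + 0 = m by rewrite addr0.
  have e2 : 0 + m = m by rewrite add0r.
  have dz : dgdiff e (closed_incl 0 z) = 0 by exact: (of_subP z).
  have := leibniz deg00 e e e e1 e2 (closed_incl 0 z) v.
  rewrite zv diff1 dz mul0L add0r sgn0 scale1r => zdv.
  rewrite -[LHS](mul1 e2) -zv (mulC0 _ v) (mulA deg00 e2 e2 e2) -zdv.
  by rewrite mul0R.
by exists (to_sub vZ); apply: of_sub_inj.
Qed.

(** Modulo this ideal every closed element is a scalar. *)
Lemma pullback_aug_ker (i : I) :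
  max_ideal (fun n => [set z : Z n | aug (p i n (closed_incl n z)) = 0]).
Proof.
have he := aug_is_aug (A_ i).
split.
- exact: (preimage_ideal (hom_comp (p i) closed_incl) (aug_ker_ideal he)).
- exists 0, (dgone Z); rewrite /= !hom1 (char1 he); apply/eqP; exact: oner_neq0.
move=> J hJ /(properP hJ) pJ NJ n z Jz; apply: contrapT => c0.
have [n0|/eqP n0] := eqVneq n 0; last by apply: c0; exact: (char_deg he).
subst n; apply: pJ; rewrite /= in c0; set c := aug _ in c0.
have Nz : aug (p i 0 (closed_incl 0 (z - c *: dgone Z))) = 0.
  by rewrite !homB !homZ !hom1 (augB he) (augZ he) (char1 he) mulr1 subrr.
have := idealZ hJ c^-1 (idealB hJ Jz (NJ _ _ Nz)).
by rewrite subKr scalerA mulVf ?scale1r //; exact/eqP.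
Qed.

Lemma Jac_closedE : Jac (A := Z) = prod_aug_ker.
Proof.
apply: functional_extensionality_dep => n; apply/seteqP; split=> z.
  by move=> hz i; exact: (hz _ (pullback_aug_ker i)).
move=> hz M hM; have [hI _ _] := hM; have hN := prod_aug_ker_ideal.
apply: (sub_maximal hI _ _ hM hN) hz => [J //||]; first exact: sum_ideal.
move=> a ha; apply: closed_inverse; apply: (prod_unit prod) => i.
by rewrite !homD !hom1; apply: aug_unit1D; exact: ha.
Qed.

Lemma Jac_closedP n (z : Z n) :
  Jac z <-> forall i, aug (p i n (closed_incl n z)) = 0.
Proof. by rewrite Jac_closedE. Qed.

Section Acyclic.
Hypothesis char2 : (2%:R : k) != 0.
Hypothesis pcA : pseudo_compact A.
Variable y : A 1.
Hypothesis dy : forall e : 1 = 0 + 1, dgdiff e y = dgone A.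

Lemma deg_y n : 1 + (n - 1) = n :> int. Proof. lia. Qed.
Lemma deg_d n : n = (n - 1) + 1 :> int. Proof. lia. Qed.

Lemma diff_mul_y m n q r (e : 1 + m = n) (h : n = q + 1) (E : m = q)
    (hm : m = r + 1) (e2 : 1 + r = q) (b : A m) :
  dgdiff h (dgmul e y b) = degcast E b - dgmul e2 y (dgdiff hm b).
Proof.
have h1 : 1 = 0 + 1 :> int by [].

have e1 : 0 + m = q by rewrite add0r.
by rewrite (leibniz e h1 hm h e1 e2) dy (mul1l e1 E) sgn1 scaleN1r.
Qed.

(** As y is odd, graded commutativity gives y y = - y y. *)
Lemma y_square n (e : 1 + 1 = n) : dgmul e y y = 0.
Proof.
have := mulC e e y y; move: (dgmul e y y) => x /eqP.
rewrite mulr1 sgn1 scaleN1r -subr_eq0 opprK -mulr2n -scaler_nat.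
by rewrite scaler_eq0 (negbTE char2) => /eqP.
Qed.

Lemma y_anticomm m n q r (e1 : 1 + n = q) (e2 : m + q = r) (e3 : m + n = r - 1)
    (e4 : 1 + (r - 1) = r) (a : A m) (b : A n) :
  dgmul e2 a (dgmul e1 y b) = sgn k m *: dgmul e4 y (dgmul e3 a b).
Proof.
have h1 : m + 1 = m + 1 by [].
have h2 : 1 + m = m + 1 by lia.
have h3 : m + 1 + n = r by lia.
rewrite -(mulA h1 h3 e1 e2) (mulC h1 h2) mulr1 mulZl.
by rewrite (mulA h2 h3 e3 e4).
Qed.

Lemma y_mul_y n q r (e1 : 1 + n = q) (e2 : 1 + q = r) (b : A n) :
  dgmul e2 y (dgmul e1 y b) = 0.
Proof.
have h1 : 1 + 1 = 1 + 1 :> int by [].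
have h2 : 1 + 1 + n = r by lia.
by rewrite -(mulA h1 h2 e1 e2) y_square mul0L.
Qed.

Lemma split_mul m n q (e : m + n = q) (x : A m) (b : A (m - 1)) (x' : A n)
    (b' : A (n - 1)) :
  dgmul e x x' + dgmul (deg_y q) y
    (dgmul (ax_e1 e) b x' + sgn k m *: dgmul (ax_e2 e) x b') =
  dgmul e (x + dgmul (deg_y m) y b) (x' + dgmul (deg_y n) y b').
Proof.
have yy : dgmul e (dgmul (deg_y m) y b) (dgmul (deg_y n) y b') = 0.
  have h1 : m - 1 + n = q - 1 by lia.
  have h2 : m - 1 + (n - 1) = q - 1 - 1 by lia.
  rewrite (mulA (deg_y m) e h1 (deg_y q)) (y_anticomm (deg_y n) h1 h2 (deg_y (q - 1))).
  by rewrite mulZr y_mul_y scaler0.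
rewrite mulDl !mulDr yy addr0 mulZr (mulA (deg_y m) e (ax_e1 e) (deg_y q)).
rewrite (y_anticomm (deg_y n) e (ax_e2 e) (deg_y q)) -!addrA; congr (_ + _).
exact: addrC.
Qed.

Local Notation JZ := (sub_nudga (ideal_dgsub (Jac_closed_ideal A))).
Local Notation DJ := (sub_nudga (ideal_dgsub (dJac_ideal A))).

(** JZ is an ideal of a subalgebra of A, so its elements carry two inclusions. *)
Definition jval n (a : JZ n) : A n := of_sub (of_sub a : Z n).

Lemma jval_closed m n (e : m = n + 1) (a : JZ m) : dgdiff e (jval a) = 0.
Proof. exact: (of_subP (of_sub a)). Qed.

Lemma jval_aug n (a : JZ n) i : aug (p i n (jval a)) = 0.
Proof.
have aJ : Jac (of_sub a : Z n).
  exact: (@of_subP _ _ (ideal_dgsub (Jac_closed_ideal A) n) a).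
exact: (iffLR (Jac_closedP _) aJ i).
Qed.

Lemma jval_inj n : injective (@jval n).
Proof. by move=> a b ab; do 2 apply: of_sub_inj. Qed.

Lemma jvalL n c (a b : JZ n) : jval (c *: a + b) = c *: jval a + jval b.
Proof. by rewrite /jval !of_subL. Qed.

Lemma jval0 n : jval (0 : JZ n) = 0. Proof. by rewrite /jval !of_sub0. Qed.

Lemma jval_cast m n (E : m = n) (a : JZ m) : jval (degcast E a) = degcast E (jval a).
Proof. by case: _ / E. Qed.

Lemma jval_exists n (a : A n) :
  (forall m (e : n = m + 1), dgdiff e a = 0) ->
  (forall i, aug (p i n a) = 0) -> exists j : JZ n, jval j = a.
Proof.
move=> da ea; have aJ : Jac (to_sub (S := closed_dgsub A n) da : Z n).
  exact/Jac_closedP.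
by exists (to_sub (aJ : ideal_dgsub (Jac_closed_ideal A) n _)).
Qed.

Lemma split_dJacP n (u : adjoin_x JZ n) :
  ideal_dgsub (dJac_ideal A) n (jval u.1 + dgmul (deg_y n) y (jval u.2)).
Proof.
apply/(dJac_diff_max prod) => i; have he := aug_is_aug (A_ i); split=> [|m e].
  by rewrite homD homM (augD he) (charM he) !jval_aug mulr0 addr0.
have E : n - 1 = m by lia.
have e2 : 1 + (n - 1 - 1) = m by lia.
rewrite -homd diffD jval_closed add0r (diff_mul_y (deg_y n) e E (deg_d (n - 1)) e2).
by rewrite jval_closed mul0R subr0 -jval_cast jval_aug.
Qed.

(** The map a + xb |-> a + yb. *)
Definition from_split n (u : adjoin_x JZ n) : DJ n := to_sub (split_dJacP u).

Lemma from_splitE n (u : adjoin_x JZ n) :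
  of_sub (from_split u) = jval u.1 + dgmul (deg_y n) y (jval u.2).
Proof. by []. Qed.

Lemma dJac_aug0 n (s : DJ n) i : aug (p i n (of_sub s)) = 0.
Proof. by have /(dJac_diff_max prod)/(_ i)[] := of_subP s. Qed.

Lemma dJac_augd m n (e : m = n + 1) (s : DJ m) i :
  aug (p i n (dgdiff e (of_sub s))) = 0.
Proof. by rewrite homd; have /(dJac_diff_max prod)/(_ i)[] := of_subP s. Qed.

Lemma dpart_ex n (s : DJ n) :
  exists j : JZ (n - 1), jval j = dgdiff (deg_d n) (of_sub s).
Proof.
by apply: jval_exists => [m e|i]; [exact: diffK | exact: dJac_augd].
Qed.

Lemma zpart_ex n (s : DJ n) :
  exists j : JZ n,
    jval j = of_sub s - dgmul (deg_y n) y (dgdiff (deg_d n) (of_sub s)).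
Proof.
apply: jval_exists => [m e|i].
  have E : n - 1 = m by lia.
  have e2 : 1 + (n - 1 - 1) = m by lia.
  rewrite diffB (diff_mul_y (deg_y n) e E (deg_d (n - 1)) e2) diffK mul0R subr0.
  case: _ / E {e2} e => e; rewrite (eq_irrelevance e (deg_d n)).
  exact: subrr.
have he := aug_is_aug (A_ i).
by rewrite homB homM (augB he) (charM he) dJac_aug0 dJac_augd mulr0 subr0.
Qed.

(** The inverse map s |-> (s - y ds) + x ds; both coefficients are closed. *)
Definition to_split n (s : DJ n) : adjoin_x JZ n :=
  (sval (cid (zpart_ex s)), sval (cid (dpart_ex s))).

Lemma to_split1 n (s : DJ n) : jval (to_split s).1 =
  of_sub s - dgmul (deg_y n) y (dgdiff (deg_d n) (of_sub s)).
Proof. exact: svalP (cid (zpart_ex s)). Qed.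

Lemma to_split2 n (s : DJ n) : jval (to_split s).2 = dgdiff (deg_d n) (of_sub s).
Proof. exact: svalP (cid (dpart_ex s)). Qed.

Lemma to_splitK n : cancel (@to_split n) (@from_split n).
Proof.
by move=> s; apply: of_sub_inj; rewrite from_splitE to_split1 to_split2 subrK.
Qed.

Lemma from_split_diff n (u : adjoin_x JZ n) :
  dgdiff (deg_d n) (of_sub (from_split u)) = jval u.2.
Proof.
have e2 : 1 + (n - 1 - 1) = n - 1 by lia.
rewrite from_splitE diffD jval_closed add0r.
rewrite (diff_mul_y (deg_y n) (deg_d n) erefl (deg_d (n - 1)) e2).
by rewrite jval_closed mul0R subr0.
Qed.

Lemma from_splitK n : cancel (@from_split n) (@to_split n).
Proof.
move=> u; rewrite [LHS]surjective_pairing [RHS]surjective_pairing.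
congr pair; apply: jval_inj; last by rewrite to_split2 from_split_diff.
by rewrite to_split1 from_split_diff from_splitE addrK.
Qed.

Lemma from_split_nu_hom : is_nu_hom from_split.
Proof.
split.
- move=> n c u v; apply: of_sub_inj.
  rewrite of_subL !from_splitE !jvalL mulR scalerDr -!addrA; congr (_ + _).
  by rewrite addrCA.
- move=> m n q e u v; apply: of_sub_inj.
  change (jval (dgmul e u.1 v.1) + dgmul (deg_y q) y
     (jval (dgmul (ax_e1 e) u.2 v.1 + sgn k m *: dgmul (ax_e2 e) u.1 v.2)) =
     dgmul e (jval u.1 + dgmul (deg_y m) y (jval u.2))
             (jval v.1 + dgmul (deg_y n) y (jval v.2))).
  exact: split_mul.
- move=> m n e u; apply: of_sub_inj.
  change (jval (degcast (ax_e3 e) u.2) + dgmul (deg_y n) y (jval (0 : JZ (n - 1))) =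
    dgdiff e (of_sub (from_split u))).
  rewrite jval0 mul0R addr0 jval_cast -from_split_diff.
  move: (ax_e3 e) => E; case: _ / E e => e; exact: diff_irr.
- move=> n; apply: subm_continuous.
  have cval m (w : adjoin_x JZ n -> JZ m) : continuous w ->
      continuous (fun u => jval (w u)).
    move=> cw; apply: comp_continuous cw _.
    exact: comp_continuous (@of_sub_cont _ _ (ideal_dgsub (Jac_closed_ideal A) m))
                           (@of_sub_cont _ _ (closed_dgsub A m)).
  apply: (pc_op_continuous (F := fun a b => a + dgmul (deg_y n) y b) pcA).
  + move=> D f; exists (fun a b => a + dgmul (deg_y n) (f 1 y) b) => a b.
    by rewrite homD homM.
  + by apply: cval; exact: fst_cont.
  + by apply: cval; exact: snd_cont.
Qed.

Lemma to_split_continuous n : continuous (@to_split n).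
Proof.
have cs : continuous (@of_sub _ _ (ideal_dgsub (dJac_ideal A) n)) by exact: of_sub_cont.
apply: pair_continuous; do 2 apply: subm_continuous.
  rewrite (_ : (fun s => _) = fun s =>
      of_sub s - dgmul (deg_y n) y (dgdiff (deg_d n) (of_sub s))); last first.
    by apply: functional_extensionality_dep => s; exact: to_split1.
  pose F (a b : A n) : A n := a - dgmul (deg_y n) y (dgdiff (deg_d n) b).
  apply: (pc_op_continuous (F := F) pcA) => // D f.
  exists (fun a b => a - dgmul (deg_y n) (f 1 y) (dgdiff (deg_d n) b)) => a b.
  by rewrite homB homM homd.
rewrite (_ : (fun s => _) = fun s => dgdiff (deg_d n) (of_sub s)); last first.
  by apply: functional_extensionality_dep => s; exact: to_split2.
apply: (pc_op_continuous (F := fun a b : A n => dgdiff (deg_d n) b) pcA _ cs cs).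
by move=> D f; exists (fun a b => dgdiff (deg_d n) b) => a b; rewrite homd.
Qed.

Lemma acyclic_iso : dg_iso (k_Jac_closed_x A) (k_dJac A).
Proof.
exact: adjoin_unit_iso from_split_nu_hom from_splitK to_splitK to_split_continuous.
Qed.

End Acyclic.
End JacClosed.

Theorem proposition4p21 (k : closedFieldType) (char0 : [pchar k] =i pred0)
    (A : pcdga k) (P : locpc k) (GAP : is_G A P) :
  (~ is_exact (dgone A) -> hinich_iso (hinich_part P) (k_dJac A)) /\
  (is_exact (dgone A) -> hinich_iso (hinich_part P) (k_Jac_closed_x A)).
Proof.
have [HK [I [A_ [p prod]]]] := is_G_iso GAP.
have hinH := hinich_part_hinich P.
have toK (C : dga k) : dg_iso C (k_dJac A) -> is_hinich C.
  by move=> CK; apply: iso_hinich CK (k_dJac_pc prod) (dJac_aug prod) _.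
have idK : dg_iso (k_dJac A) (k_dJac A).
  by exists (hom_id _), (hom_id _).
split=> [_|]; first by split=> //; exact: toK.
move=> [m [e [y dy]]].
have E : (m : int) = (1 : int) by rewrite e.
subst m.
have char2 : (2%:R : k) != 0.
  by have := char0 2%N; rewrite !inE /= => /negbT.
have dy' e' : dgdiff e' y = dgone A by rewrite -dy; exact: diff_irr.
have JK := acyclic_iso prod char2 (pc_pc A) dy'.
split=> //; first exact: toK.
exact: iso_trans HK (iso_sym JK).
Qed.
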